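(* Let $d\in\mathbb{N}$, and let $\Phi:\mathsf{D}(\mathbb{R}_+,\mathbb{R}^d)\to\mathsf{D}(\mathbb{R}_+,\mathbb{R}^{3d})$ and $\Phi_n:\mathsf{D}(\mathbb{R}_+,\mathbb{R}^d)\to\mathsf{D}(\mathbb{R}_+,\mathbb{R}^{3d})$, $n\in\mathbb{N}$, be the mappings defined by $$(\Phi(f))(t):=\begin{bmatrix} f(t)\\ \int_0^t f(s)\,ds\\ \int_0^t\left(\int_0^r f(s)\,ds\right)dr\end{bmatrix},\qquad (\Phi_n(f))(t):=\begin{bmatrix} f(t)\\ \int_0^{\frac{\lfloor nt\rfloor}{n}} f(s)\,ds\\ \int_0^{\frac{\lfloor nt\rfloor}{n}}\left(\int_0^{\frac{\lfloor nr\rfloor}{n}} f(s)\,ds\right)dr\end{bmatrix}$$ for $n\in\mathbb{N}$, $t\in\mathbb{R}_+$ and $f\in\mathsf{D}(\mathbb{R}_+,\mathbb{R}^d)$. If $(\boldsymbol{\mathcal{U}}_t)_{t\in\mathbb{R}_+}$ and $(\boldsymbol{\mathcal{U}}^{(n)}_t)_{t\in\mathbb{R}_+}$, $n\in\mathbb{N}$, are $\mathbb{R}^d$-valued stochastic processes with càdlàg paths such that $\mathbb{P}(\boldsymbol{\mathcal{U}}\in\mathsf{C}(\mathbb{R}_+,\mathbb{R}^d))=1$ and $\boldsymbol{\mathcal{U}}^{(n)}\stackrel{\mathcal{D}}{\longrightarrow}\boldsymbol{\mathcal{U}}$ as $n\to\infty$, then $\Phi_n(\boldsymbol{\mathcal{U}}^{(n)})\stackrel{\mathcal{D}}{\longrightarrow}\Phi(\boldsymbol{\mathcal{U}})$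 as $n\to\infty$.
   Context: $\mathbb{R}_+=[0,\infty)$, $\mathbb{N}=\{1,2,\dots\}$. $\mathsf{D}(\mathbb{R}_+,\mathbb{R}^q)$ and $\mathsf{C}(\mathbb{R}_+,\mathbb{R}^q)$ denote the spaces of càdlàg (right continuous with left limits) and continuous functions $\mathbb{R}_+\to\mathbb{R}^q$, respectively. $\mathsf{D}(\mathbb{R}_+,\mathbb{R}^q)$ carries the Skorokhod $J_1$ topology and its Borel $\sigma$-algebra. For processes with càdlàg paths, $\stackrel{\mathcal{D}}{\longrightarrow}$ denotes weak convergence of their distributions on $\mathsf{D}(\mathbb{R}_+,\mathbb{R}^q)$. *)

(* Defs.v *)
From HB Require Import structures.
From mathcomp Require Import all_boot all_order all_algebra.
From mathcomp Require Import all_classical all_reals all_analysis.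
From mathcomp Require Import ring lra.

Set Implicit Arguments.
Unset Strict Implicit.
Unset Printing Implicit Defensive.

Import Order.TTheory GRing.Theory Num.Theory.
Import numFieldNormedType.Exports.

Local Open Scope classical_set_scope.
Local Open Scope ring_scope.

(* Only the restriction of [f] to [0, +oo[ matters: the filters [t^'+] (t >= 0)
   and [t^'-] (t > 0) do not see negative times. *)
Definition cadlag {R : realType} {V : topologicalType} (f : R -> V) : Prop :=
  (forall t : R, 0 <= t -> f x @[x --> t^'+] --> f t) /\
  (forall t : R, 0 < t -> exists l : V, f x @[x --> t^'-] --> l).

Section cadlag_theory.
Context {R : realType}.
Notation mu := (@lebesgue_measure R).

Lemma cvg_mxP (T : Type) (F : set_system T) (FF : Filter F) (m n : nat)
    (f : T -> 'M[R]_(m, n)) (M : 'M[R]_(m, n)) :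
  f x @[x --> F] --> M <-> forall i j, f x i j @[x --> F] --> M i j.
Proof.
split=> [fM i j|fM].
  exact: (cvg_comp _ _ fM (@coord_continuous R m n i j M)).
move=> A [P MP sPA].
suff : \forall x \near F, forall i j, P i j (f x i j).
  by apply: filterS => x Px; exact: sPA.
by apply: filter_forall => i; apply: filter_forall => j; apply: fM; exact: MP.
Qed.

Lemma cadlag_mxP (m n : nat) (f : R -> 'M[R]_(m, n)) :
  cadlag f <-> forall i j, cadlag (fun t => f t i j).
Proof.
split=> [[fr fl] i j|fc].
  split=> t t0; first by have /cvg_mxP := fr t t0; exact.
  by have [l /cvg_mxP fl'] := fl t t0; exists (l i j).
split=> t t0; first by apply/cvg_mxP => i j; have [+ _] := fc i j; exact.
exists (\matrix_(i, j) lim (f x i j @[x --> t^'-])).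
apply/cvg_mxP => i j; rewrite mxE; have [_ /(_ _ t0)] := fc i j.
by move=> /cvg_ex.
Qed.

Lemma cadlag_cst (V : topologicalType) (v : V) : cadlag (fun _ : R => v).
Proof. by split=> t t0; [|exists v]; exact: cvg_cst. Qed.

Lemma cadlag_bounded (f : R -> R) (T : R) : cadlag f ->
  exists M : R, forall t, 0 <= t <= T -> `|f t| <= M.
Proof.
move=> [fr fl].
have : \forall N \near +oo, `[0, T]%classic `<=` (fun x => 0 <= x -> `|f x| <= N).
  have /compact_near_coveringP cpt := @segment_compact R 0 T.
  apply: (cpt _ _ (fun N x => 0 <= x -> `|f x| <= N)) => t.
  rewrite /= in_itv/= => /andP[t0 _].
  suff [M tM] : exists M, \forall x \near t, 0 <= x -> `|f x| <= M.
    exists ([set x : R | 0 <= x -> `|f x| <= M], [set N : R | M <= N]).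
      by split => //=; exact: nbhs_pinfty_ge (num_real _).
    by move=> [x N]/= [xM MN] x0; exact: le_trans (xM x0) MN.
  have bnd (F : set_system R) (l : R) : Filter F -> f x @[x --> F] --> l ->
      \forall x \near F, `|f x| <= `|l| + 1.
    move=> FF /cvgrPdist_le/(_ 1 ltr01); apply: filterS => x lx.
    by rewrite -[f x](subKr l) (le_trans (ler_normB _ _))// lerD2l.
  have Hr : \forall x \near t, t < x -> `|f x| <= `|f t| + 1.
    exact: (bnd _ _ (@at_right_proper_filter R t) (fr t t0)).
  have [l Hl] : exists l, \forall x \near t, x < t -> 0 <= x -> `|f x| <= l.
    move: t0; rewrite le_eqVlt => /predU1P[<-|t0].
      exists 0; apply: (@filterE _ _ (nbhs_filter (0 : R))) => x /= x0.
      by rewrite leNgt x0.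
    have [l fl'] := fl t t0.
    exists (`|l| + 1).
    have : \forall x \near t, x < t -> `|f x| <= `|l| + 1.
      exact: (bnd _ _ (@at_left_proper_filter R t) fl').
    by apply: filterS => x fx xt _; exact: fx.
  exists (Num.max l (`|f t| + 1)); near=> x => x0; rewrite le_max.
  have [xt|tx|->] := ltgtP x t.
  - by apply/orP; left; move: xt x0; near: x.
  - by apply/orP; right; move: tx; near: x.
  - by rewrite lerDl ler01 orbT.
move=> /(pinfty_ex_ge (num_real 0))[N _ HN]; exists N => t tT.
by apply: HN; [rewrite /= in_itv|case/andP: tT].
Unshelve. all: by end_near. Qed.

Lemma cvg_floor_right (t : R) : (((Num.floor (n.+1%:R * t))%:~R + 1) / n.+1%:R : R)
  @[n --> \oo] --> t.
Proof.
apply/cvgrPdist_le => e e0; near=> n.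
have n0 : (0 : R) < n.+1%:R by rewrite ltr0n.
have /andP[f1 f2] := floor_itv (n.+1%:R * t).
rewrite rmorphD/= in f2.
have en : n.+1%:R^-1 <= e.
  rewrite -[e]invrK lef_pV2 ?posrE ?invr_gt0//.
  near: n; exists `|Num.ceil e^-1|%N => // k /= ke.
  apply: le_trans (ceil_ge _) _.
  apply: (@le_trans _ _ (`|Num.ceil e^-1|%N%:R)).
    by rewrite natr_absz ler_int; exact: ler_norm.
  by rewrite ler_nat (leq_trans ke).
apply: le_trans en.
have -> : t - ((Num.floor (n.+1%:R * t))%:~R + 1) / n.+1%:R =
  (n.+1%:R * t - ((Num.floor (n.+1%:R * t))%:~R + 1)) / n.+1%:R.
  by rewrite mulrBl mulrAC divff ?mul1r// lt0r_neq0.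
rewrite normrM normfV (gtr0_norm n0) ler_piMl ?invr_ge0 ?(ltW n0)//.
rewrite ler_norml; apply/andP; split; lra.
Unshelve. all: by end_near. Qed.

Lemma measurable_fun_cadlag (f : R -> R) : cadlag f ->
  measurable_fun `[(0:R), +oo[ f.
Proof.
move=> [fr _].
pose h (n : nat) (t : R) :=
  f (((Num.floor (n.+1%:R * t))%:~R + 1) / n.+1%:R).
apply: (measurable_realfun.measurable_fun_cvg (h := h)) => [n _ A mA|t].
  rewrite [X in measurable X](_ : _ = \bigcup_(k in
      [set k : nat | A (f ((k%:R + 1) / n.+1%:R))])
      `[k%:R / n.+1%:R : R, (k%:R + 1) / n.+1%:R[%classic).
    by apply: bigcup_measurable => k _; exact: measurable_itv.
  have n0 : (0 : R) < n.+1%:R by rewrite ltr0n.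
  apply/seteqP; split=> t /=.
    rewrite in_itv/= andbT => -[t0 At].
    have F0 : 0 <= Num.floor (n.+1%:R * t).
      by rewrite floor_ge0 mulr_ge0// ltW.
    have /andP[f1 f2] := floor_itv (n.+1%:R * t).
    exists `|Num.floor (n.+1%:R * t)|%N => /=.
      by rewrite natr_absz ger0_norm.
    rewrite /= in_itv/= natr_absz ger0_norm// ler_pdivrMr// ltr_pdivlMr//.
    by rewrite rmorphD/= in f2; rewrite ![t * _]mulrC f1.
  move=> [k /= Ak]; rewrite !in_itv/= andbT ler_pdivrMr// ltr_pdivlMr// => tk.
  split.
    by case/andP: tk => tk _; rewrite -(pmulr_lge0 _ n0) (le_trans _ tk).
  rewrite /h (@floor_def _ _ k%:Z)//.
  by rewrite rmorphD/= ![_ * t]mulrC.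
rewrite /= in_itv/= andbT => t0.
have /cvg_at_rightP := fr t t0; apply; split; last exact: cvg_floor_right.
move=> n; rewrite ltr_pdivlMr ?ltr0n// mulrC.
by have /andP[_] := floor_itv (n.+1%:R * t); rewrite rmorphD.
Qed.

Lemma integrable_cadlag (f : R -> R) (T : R) : cadlag f ->
  mu.-integrable `[0, T] (EFin \o f).
Proof.
move=> fc; apply: measurable_bounded_integrable => //.
- by rewrite /= lebesgue_measure_itv; case: ifP => // _; rewrite ltry.
- apply: measurable_funS (measurable_fun_cadlag fc) => //.
  by move=> x /=; rewrite !in_itv/= => /andP[->].
- have [M fM] := cadlag_bounded T fc; exists M; split; first exact: num_real.
  by move=> N MN t /=; rewrite in_itv/= => /fM; move/le_trans; apply; exact: ltW.
Qed.

Lemma cadlag_int (f : R -> R) : cadlag f ->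
  cadlag (fun t => \int[mu]_(s in `[0, t]) f s).
Proof.
move=> fc.
have cf (T : R) : 0 < T -> let F t := \int[mu]_(s in `[0, t]) f s in
    [/\ {in `]0, T[, continuous F}, F @ 0^'+ --> F 0 & F @ T^'- --> F T].
  move=> T0; apply/(continuous_within_itvP _ T0).
  exact: parameterized_integral_continuous (ltW T0) (integrable_cadlag _ fc).
split=> t t0.
  have t1 : 0 < t + 1 by lra.
  have [+ + _] := cf _ t1.
  move: t0; rewrite le_eqVlt => /predU1P[<-//|t0] /(_ t) + _.
  rewrite in_itv/= t0 ltrDl ltr01 => /(_ isT); exact: cvg_at_right_filter.
exists (\int[mu]_(s in `[0, t]) f s).
by have [_ _] := cf _ t0.
Qed.

(* No regularity of [G] is needed: [t |-> floor (n * t) / n] is a cadlag step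
   function. *)
Lemma cadlag_floor (V : topologicalType) (G : R -> V) (n : nat) :
  cadlag (fun t : R => G ((Num.floor (n%:R * t))%:~R / n%:R)).
Proof.
have [->|n0] := posnP n.
  rewrite (_ : (fun _ => _) = fun=> G 0); first exact: cadlag_cst.
  by apply/funext => t; rewrite invr0 mulr0.
have nR : (0 : R) < n%:R by rewrite ltr0n.
split=> t _.
  have /andP[f1 f2] := floor_itv (n%:R * t).
  have tF : t < (Num.floor (n%:R * t) + 1)%:~R / n%:R.
    by rewrite ltr_pdivlMr// mulrC.
  apply: cvg_near_cst; near=> x.
  suff -> : Num.floor (n%:R * x) = Num.floor (n%:R * t) by [].
  apply: floor_def; apply/andP; split.
    rewrite (le_trans f1)// ler_pM2l//; near: x; exact: nbhs_right_ge.
  by rewrite mulrC -ltr_pdivlMr//; near: x; exact: nbhs_right_lt.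
exists (G ((Num.ceil (n%:R * t) - 1)%:~R / n%:R)).
have /andP[f1 f2] := ceil_itv (n%:R * t).
have cT : (Num.ceil (n%:R * t) - 1)%:~R / n%:R < t.
  by rewrite ltr_pdivrMr// [t * _]mulrC.
apply: cvg_near_cst; near=> x.
suff -> : Num.floor (n%:R * x) = Num.ceil (n%:R * t) - 1 by [].
apply: floor_def; rewrite subrK; apply/andP; split.
  by rewrite [n%:R * x]mulrC -ler_pdivrMr//; near: x; exact: nbhs_left_ge.
rewrite (lt_le_trans _ f2)// ltr_pM2l//; near: x; exact: nbhs_left_lt.
Unshelve. all: by end_near. Qed.

End cadlag_theory.

(* The space D(R_+, R^q).  A path is stored as a function on the whole real line
   that vanishes on ]-oo, 0[, so that equality of elements is equality of the
   paths on R_+. *)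
Record skorokhod (R : realType) (q : nat) := Skorokhod {
  path_fun :> R -> 'cV[R]_q;
  path_neg : forall t, t < 0 -> path_fun t = 0;
  path_cadlag : cadlag path_fun }.

HB.instance Definition _ (R : realType) (q : nat) :=
  gen_eqMixin (skorokhod R q).
HB.instance Definition _ (R : realType) (q : nat) :=
  gen_choiceMixin (skorokhod R q).

Definition skorokhod0 (R : realType) (q : nat) : skorokhod R q :=
  Skorokhod (fun _ _ => erefl) (cadlag_cst (0 : 'cV[R]_q)).

HB.instance Definition _ (R : realType) (q : nat) :=
  isPointed.Build (skorokhod R q) (skorokhod0 R q).

(* Continuous strictly increasing [lam : R_+ -> R_+] with [lam 0 = 0] and
   [lam t --> +oo]. *)
Definition time_change {R : realType} (lam : R -> R) : Prop :=
  [/\ lam 0 = 0,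
      {in `[0, +oo[ &, {homo lam : s t / s < t}},
      {within `[0, +oo[, continuous lam} &
      lam t @[t --> +oo] --> +oo].

Section skorokhod_topology.
Context {R : realType} {q : nat}.
Implicit Types (f g : skorokhod R q) (A B : set (skorokhod R q)).

(* In the J1 topology, [f_ n] converges to [f] iff there are time changes
   [lam_ n] such that [sup_(t >= 0) |lam_ n t - t|] tends to 0 and, for every
   [T], [sup_(0 <= t <= T) |f_ n (lam_ n t) - f t|] tends to 0; that is, iff
   [f_ n] is eventually in each of the sets [j1_nbh f T e].  As the J1 topology
   is metrizable, these sets generate its filter of neighbourhoods of [f]. *)
Definition j1_nbh f (T e : R) : set (skorokhod R q) :=
  [set g | exists lam : R -> R, [/\ time_change lam,
    forall t, 0 <= t -> `|lam t - t| < e &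
    forall t, 0 <= t <= T -> `|g (lam t) - f t| < e]].

Definition j1_open A : Prop :=
  forall f, A f -> exists T e : R, 0 < e /\ j1_nbh f T e `<=` A.

Lemma sub_j1_nbh f (T T' e e' : R) : T' <= T -> e <= e' ->
  j1_nbh f T e `<=` j1_nbh f T' e'.
Proof.
move=> TT ee g [lam [tlam lam1 lam2]]; exists lam; split=> // t t0.
  exact: lt_le_trans (lam1 t t0) ee.
apply: lt_le_trans (lam2 t _) ee.
by case/andP: t0 => -> /le_trans; exact.
Qed.

Lemma j1_openT : j1_open setT.
Proof. by move=> f _; exists 0, 1; split. Qed.

Lemma j1_openI : setI_closed j1_open.
Proof.
move=> A B oA oB f [/oA[T [e [e0 sA]]] /oB[T' [e' [e'0 sB]]]].
exists (Num.max T T'), (Num.min e e'); split; first by rewrite lt_min e0.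
move=> g fg; split; [apply: sA|apply: sB]; apply: sub_j1_nbh fg.
- by rewrite le_max lexx.
- by rewrite ge_min lexx.
- by rewrite le_max lexx orbT.
- by rewrite ge_min lexx orbT.
Qed.

Lemma j1_open_bigU (I : Type) (F : I -> set (skorokhod R q)) :
  (forall i, j1_open (F i)) -> j1_open (\bigcup_i F i).
Proof.
move=> oF f [i _ /oF[T [e [e0 sF]]]]; exists T, e; split=> //.
by move=> g /sF Fg; exists i.
Qed.

HB.instance Definition _ := isOpenTopological.Build (skorokhod R q)
  j1_openT j1_openI j1_open_bigU.

End skorokhod_topology.

Notation borel T := (g_sigma_algebraType (@open T)).

Definition weak_cvg {R : realType} {S : ptopologicalType}
    (mu_ : nat -> probability (borel S) R) (mu : probability (borel S) R) : Prop :=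
  forall g : S -> R, continuous g -> bounded_fun g ->
    \int[mu_ n]_x g x @[n --> \oo] --> \int[mu]_x g x.

(* The maps [X_ n] and [X] are Borel measurable, so that they have distributions
   on [borel S], and these distributions converge weakly.  Each [X_ n] may live
   on its own probability space. *)
Definition cvg_in_law {R : realType} {S : ptopologicalType}
    {disp_ : nat -> measure_display} {W_ : forall n, measurableType (disp_ n)}
    (P_ : forall n, probability (W_ n) R) (X_ : forall n, W_ n -> S)
    {disp : measure_display} {W : measurableType disp}
    (P : probability W R) (X : W -> S) : Prop :=
  exists (Y_ : forall n, {mfun W_ n >-> borel S}) (Y : {mfun W >-> borel S}),
    [/\ forall n w, Y_ n w = X_ n w,
        forall w, Y w = X w &
        weak_cvg (fun n => distribution (P_ n) (Y_ n)) (distribution P Y)].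

Definition is_process {R : realType} {q : nat} {d : measure_display}
    {W : measurableType d} (X : W -> skorokhod R q) : Prop :=
  forall t : R, 0 <= t -> forall i, measurable_fun setT (fun w => X w t i 0).

Section integral_maps.
Context {R : realType} {d : nat}.

Definition vint (f : R -> 'cV[R]_d) (t : R) : 'cV[R]_d :=
  \col_i \int[lebesgue_measure]_(s in `[0, t]) f s i 0.

Definition grid (n : nat) (t : R) : R := (Num.floor (n%:R * t))%:~R / n%:R.

Definition Phi_fun (f : R -> 'cV[R]_d) (t : R) : 'cV[R]_(d + (d + d)) :=
  col_mx (f t) (col_mx (vint f t) (vint (vint f) t)).

Definition Phin_fun (n : nat) (f : R -> 'cV[R]_d) (t : R) :
    'cV[R]_(d + (d + d)) :=
  col_mx (f t) (col_mx (vint f (grid n t))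
    (vint (fun r => vint f (grid n r)) (grid n t))).

Lemma vint_le0 (f : R -> 'cV[R]_d) (t : R) : t <= 0 -> vint f t = 0.
Proof.
rewrite le_eqVlt => t0; apply/colP => i; rewrite !mxE.
case/predU1P: t0 => [->|t0]; first by rewrite set_itv1 Rintegral_set1.
by rewrite set_itv_ge ?Rintegral_set0// bnd_simp -ltNge.
Qed.

Lemma grid_lt0 (n : nat) (t : R) : t < 0 -> grid n t <= 0.
Proof.
move=> t0; rewrite mulr_le0_ge0 ?invr_ge0// -[leRHS]/(0%:~R) ler_int floor_le0.
by apply: le_lt_trans ltr01; rewrite mulr_ge0_le0// ltW.
Qed.

Lemma cadlag_col_mx (m n : nat) (f : R -> 'cV[R]_m) (g : R -> 'cV[R]_n) :
  cadlag f -> cadlag g -> cadlag (fun t => col_mx (f t) (g t)).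
Proof.
move=> /cadlag_mxP fc /cadlag_mxP gc; apply/cadlag_mxP => i j.
case: (split_ordP i) => k ->.
- by under [X in cadlag X]funext do rewrite col_mxEu; exact: fc.
- by under [X in cadlag X]funext do rewrite col_mxEd; exact: gc.
Qed.

Lemma cadlag_vint (f : R -> 'cV[R]_d) : cadlag f -> cadlag (vint f).
Proof.
move=> /cadlag_mxP fc; apply/cadlag_mxP => i j.
by under [X in cadlag X]funext do rewrite mxE; exact: cadlag_int.
Qed.

Lemma Phi_neg (f : skorokhod R d) (t : R) : t < 0 -> Phi_fun f t = 0.
Proof.
by move=> t0; rewrite /Phi_fun path_neg// !vint_le0 ?(ltW t0)// !col_mx0.
Qed.

Lemma Phi_cadlag (f : skorokhod R d) : cadlag (Phi_fun f).
Proof.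
have fc := path_cadlag f; apply: (cadlag_col_mx fc).
by apply: cadlag_col_mx; do ?exact: cadlag_vint; do 2!apply: cadlag_vint.
Qed.

Lemma Phin_neg (n : nat) (f : skorokhod R d) (t : R) :
  t < 0 -> Phin_fun n f t = 0.
Proof.
move=> t0; rewrite /Phin_fun path_neg//.
by rewrite !(vint_le0 _ (grid_lt0 n t0)) !col_mx0.
Qed.

Lemma Phin_cadlag (n : nat) (f : skorokhod R d) : cadlag (Phin_fun n f).
Proof.
apply: cadlag_col_mx; first exact: path_cadlag.
by apply: cadlag_col_mx; exact: cadlag_floor.
Qed.

Definition Phi (f : skorokhod R d) : skorokhod R (d + (d + d)) :=
  Skorokhod (Phi_neg f) (Phi_cadlag f).

Definition Phin (n : nat) (f : skorokhod R d) : skorokhod R (d + (d + d)) :=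
  Skorokhod (Phin_neg n f) (Phin_cadlag n f).

End integral_maps.

(* Main.v *)
Require Import Defs.
From mathcomp Require Import all_boot all_order all_algebra.
From mathcomp Require Import all_classical all_reals all_analysis.
From mathcomp Require Import measurable_realfun ring lra.

Set Implicit Arguments.
Unset Strict Implicit.
Unset Printing Implicit Defensive.

Import Order.TTheory GRing.Theory Num.Theory.
Import numFieldNormedType.Exports.

Local Open Scope classical_set_scope.
Local Open Scope ring_scope.

(** The map [Phi] is continuous for the J1 topology, but the maps [Phin n] are
not, because they mix the jumps of the path with jumps at deterministic grid
times.  What holds is convergence along sequences: if [f_ n] tends to [f] in J1
and [f] is continuous, then the convergence is uniform on bounded intervals,
hence so is that of the integrals, and replacing [t] by the grid point before
it costs a multiple of the grid step, the limit integrals being Lipschitz on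
bounded intervals.  So [Phin n (f_ n)] tends to [Phi f] for every continuous
[f] ([Phin_cvg]), and almost every path of the limit process is continuous.

The theorem thus follows from a continuous mapping theorem for a varying
sequence of maps that converges at almost every point of the limit law
([extended_mapping_weak_cvg]).  It is proved without a Skorokhod representation
and without the portmanteau theorem: a bounded continuous function composed with
the maps is bounded below by Lipschitz functions, to which weak convergence
applies.  Lipschitz functions require an explicit distance for the J1 topology;
[j1_dist] is one.

Convergence in law includes the Borel measurability of [Phin n \o U_ n] and
[Phi \o U].  Their coordinates are measurable by Fubini's theorem, and a map
into D with measurable coordinates is Borel measurable ([measurable_process]):
it is the pointwise J1 limit of discretizations that take countably many values,
and a pointwise limit of measurable maps into a metrizable space is measurable.
The discretizations converge because a cadlag path has, on any bounded interval,
a finite partition into intervals of small oscillation, whose endpoints a small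
time change moves onto the grid ([grid_aligned_near]). *)

(** * Time changes *)

Section time_changes.
Context {R : realType}.
Implicit Types (lam mu : R -> R).

Lemma within_continuous_ge0P (V : normedModType R) (f : R -> V) :
  {within `[0, +oo[, continuous f} <->
  forall t e : R, 0 <= t -> 0 < e -> exists2 d : R, 0 < d &
    forall s, 0 <= s -> `|s - t| < d -> `|f s - f t| < e.
Proof.
split=> [/subspace_continuousP fc t e t0 e0|fc].
  have /cvgrPdist_lt/(_ e e0) : f x @[x --> within `[0, +oo[ (nbhs t)] --> f t.
    by apply: fc; rewrite /= in_itv/= t0.
  rewrite /prop_near1/within/= => /nbhs_ballP[d d0 H]; exists d => // s s0 st.
  rewrite distrC; apply: H; last by rewrite /= in_itv/= s0.
  by rewrite -ball_normE/= distrC.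
apply/subspace_continuousP => t; rewrite /= in_itv/= andbT => t0.
apply/cvgrPdist_lt => e e0; have [d d0 H] := fc t e t0 e0.
rewrite /prop_near1/within/=; apply/nbhs_ballP; exists d => // s.
rewrite -ball_normE/= => st; rewrite in_itv/= andbT => s0.
by rewrite distrC; apply: H => //; rewrite distrC.
Qed.

Lemma time_change_le lam (s t : R) :
  time_change lam -> 0 <= s -> s <= t -> lam s <= lam t.
Proof.
move=> [_ lam_lt _ _] s0; rewrite le_eqVlt => /predU1P[->//|st].
by apply/ltW/lam_lt => //; rewrite in_itv/= andbT// (le_trans s0)// ltW.
Qed.

Lemma time_change_ge0 lam (t : R) : time_change lam -> 0 <= t -> 0 <= lam t.
Proof.
by move=> tc t0; have [<- _ _ _] := tc; exact: time_change_le.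
Qed.

Lemma time_change_surj lam (y : R) :
  time_change lam -> 0 <= y -> exists2 x, 0 <= x & lam x = y.
Proof.
move=> tc y0; have [lam0 _ lamc /cvgryPge/(_ y) lamy] := tc.
have [x [x0 yx]] : exists x, 0 <= x /\ y <= lam x.
  near +oo_R => x; exists x; split; near: x => //.
  exact: nbhs_pinfty_ge (num_real _).
have [||c] := @IVT R lam 0 x y x0.
- apply: continuous_subspaceW lamc => z /=.
  by rewrite !in_itv/= andbT => /andP[].
- by rewrite lam0 ge_min y0/= le_max yx orbT.
by rewrite in_itv/= => /andP[c0 _] <-; exists c.
Unshelve. all: by end_near. Qed.

(** Continuity comes for free: a monotone map has only jump discontinuities, and
a jump would be skipped by the range. *)
Lemma time_changeP lam : lam 0 = 0 ->
  (forall s t, 0 <= s -> s < t -> lam s < lam t) ->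
  (forall y, 0 <= y -> exists2 x, 0 <= x & lam x = y) -> time_change lam.
Proof.
move=> lam0 lam_lt lam_surj.
have lam_le s t : 0 <= s -> s <= t -> lam s <= lam t.
  by move=> s0; rewrite le_eqVlt => /predU1P[->//|/lam_lt-/(_ s0)/ltW].
split => //.
- by move=> s t; rewrite !in_itv/= !andbT => s0 _; exact: lam_lt.
- apply/within_continuous_ge0P => t e t0 e0.
  have lamt0 : 0 <= lam t by rewrite -lam0 lam_le.
  have [b b0 bt] := lam_surj (lam t + e / 2) ltac:(lra).
  have tb : t < b.
    by rewrite ltNge; apply/negP => /(lam_le _ _ b0); rewrite bt; lra.
  have [a at_ Ha] : exists2 a, a < t & forall s, 0 <= s -> a < s -> lam t - e < lam s.
    have [lte|elt] := ltP (lam t) e.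
      exists (t - 1); first lra.
      move=> s s0 _; have : 0 <= lam s by rewrite -lam0 lam_le.
      lra.
    have [a a0 ea] := lam_surj (lam t - e) ltac:(lra).
    exists a; last by move=> s s0 /(lam_lt _ _ a0); rewrite ea.
    by rewrite ltNge; apply/negP => /(lam_le _ _ t0); rewrite ea; lra.
  exists (Num.min (b - t) (t - a)); first by rewrite lt_min !subr_gt0 tb.
  move=> s s0; rewrite lt_min !ltr_norml => /andP[/andP[_ sb] /andP[as_ _]].
  have sb' : s <= b by lra.
  have as' : a < s by lra.
  have := lam_le _ _ s0 sb'; have := Ha _ s0 as'; rewrite bt => ? ?.
  by apply/andP; split; lra.
- apply/cvgryPge => A; have [|x x0 xA] := lam_surj (Num.max A 0).
    by rewrite le_max lexx orbT.
  near=> t; apply: (@le_trans _ _ (lam x)); first by rewrite xA le_max lexx.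
  by apply: lam_le => //; near: t; exact: nbhs_pinfty_ge (num_real _).
Unshelve. all: by end_near. Qed.

Lemma time_change_id : time_change (@id R).
Proof. by apply: time_changeP => // y y0; exists y. Qed.

Lemma time_change_comp lam mu :
  time_change lam -> time_change mu -> time_change (mu \o lam).
Proof.
move=> tl tm; have [l0 llt _ _] := tl; have [m0 mlt _ _] := tm.
apply: time_changeP => [|s t s0 st|y y0] /=; first by rewrite l0 m0.
  have t0 : 0 <= t by rewrite (le_trans s0)// ltW.
  apply: mlt; rewrite ?in_itv/= ?andbT; try exact: time_change_ge0.
  by apply: llt => //; rewrite in_itv/= andbT.
have [x x0 <-] := time_change_surj tm y0.
by have [z z0 <-] := time_change_surj tl x0; exists z.
Qed.

Lemma time_change_inv lam : time_change lam ->
  exists mu, [/\ time_change mu, forall t, 0 <= t -> mu (lam t) = t &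
                 forall t, 0 <= t -> lam (mu t) = t].
Proof.
move=> tl; have [l0 llt _ _] := tl.
have lam_inj s t : 0 <= s -> 0 <= t -> lam s = lam t -> s = t.
  move=> s0 t0 st; have [h|h|//] := ltgtP s t.
  - have := llt s t; rewrite !in_itv/= !andbT => /(_ s0 t0 h).
    by rewrite st ltxx.
  - have := llt t s; rewrite !in_itv/= !andbT => /(_ t0 s0 h).
    by rewrite st ltxx.
have /choice[mu muP] : forall y, exists x, 0 <= y -> 0 <= x /\ lam x = y.
  move=> y; have [y0|y0] := leP 0 y; last by exists 0.
  by have [x x0 xy] := time_change_surj tl y0; exists x.
have mulam t : 0 <= t -> mu (lam t) = t.
  by move=> t0; have [? ?] := muP _ (time_change_ge0 tl t0); exact: lam_inj.
have lammu t : 0 <= t -> lam (mu t) = t by move=> /muP[].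
exists mu; split=> //; apply: time_changeP => [|s t s0 st|y y0].
- by rewrite -[X in mu X]l0 mulam.
- rewrite ltNge; apply/negP => ts; have t0 : 0 <= t by lra.
  have [mt0 _] := muP _ t0.
  by have := time_change_le tl mt0 ts; rewrite !lammu//; lra.
- by exists (lam y); [exact: time_change_ge0|exact: mulam].
Qed.

Definition glue (u : R) lam mu : R -> R :=
  fun t => if t <= u then lam t else lam u + mu (t - u).

Lemma time_change_glue (u : R) lam mu : 0 <= u ->
  time_change lam -> time_change mu -> time_change (glue u lam mu).
Proof.
move=> u0 tl tm; have [l0 llt _ _] := tl; have [m0 mlt _ _] := tm.
have lu0 := time_change_ge0 tl u0.
rewrite /glue; apply: time_changeP => [|s t s0 st|y y0]; first by rewrite u0.
- have t0 : 0 <= t by lra.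
  have [tu|ut] := leP t u.
    rewrite (le_trans (ltW st) tu); apply: llt => //;
    by rewrite in_itv/= andbT.
  have [su|us] := leP s u.
    apply: (le_lt_trans (time_change_le tl s0 su)).
    by rewrite ltrDl -m0; apply: mlt; rewrite ?in_itv/= ?andbT; lra.
  by rewrite ltrD2l; apply: mlt; rewrite ?in_itv/= ?andbT; lra.
- have [ylu|luy] := leP y (lam u).
    have [x x0 xy] := time_change_surj tl y0; exists x => //; case: ifPn => //.
    rewrite -ltNge => ux; have : lam u < lam x.
      by apply: llt => //; rewrite in_itv/= andbT.
    by rewrite xy ltNge ylu.
  have y1 : 0 <= y - lam u by lra.
  have [x x0 xy] := time_change_surj tm y1.
  exists (x + u); first lra.
  case: ifPn => [xu|_]; last by rewrite addrK xy; lra.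
  have x00 : x = 0 by lra.
  by move: xy; rewrite x00 m0; lra.
Qed.

Definition stretch (a b : R) : R -> R := glue a (fun t => t * (b / a)) id.

Lemma time_change_stretch (a b : R) : 0 < a -> 0 < b ->
  time_change (stretch a b).
Proof.
move=> a0 b0; apply: time_change_glue (ltW a0) _ time_change_id.
have ba : 0 < b / a by rewrite divr_gt0.
apply: time_changeP => [|s t _ st|y y0]; first by rewrite mul0r.
  by rewrite ltr_pM2r.
exists (y / (b / a)); first by rewrite divr_ge0// ltW.
by rewrite divfK// gt_eqF.
Qed.

End time_changes.

(** * A distance for the J1 topology *)

(** [rho] is a pseudometric inducing the topology that [S] already carries. *)
Definition compatible_dist {R : realType} {S : topologicalType}
    (rho : S -> S -> R) : Prop :=
  [/\ forall x, rho x x = 0, forall x y, rho x y = rho y x,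
      forall x y z, rho x z <= rho x y + rho y z &
      forall x A, nbhs x A <->
        exists2 e : R, 0 < e & forall y, rho x y < e -> A y].

Section j1_distance.
Context {R : realType} {q : nat}.
Implicit Types (f g h : skorokhod R q) (A : set (skorokhod R q)).

(** One parameter bounds the displacement of the time change, the distance of
the paths, and the inverse of the time horizon.  Putting the horizon condition
on [t] or on [lam t] makes the relation symmetric under inversion of the time
change. *)
Definition j1_close (e : R) f g : Prop := exists lam : R -> R,
  [/\ time_change lam, forall t, 0 <= t -> `|lam t - t| < e &
      forall t, 0 <= t -> t <= e^-1 \/ lam t <= e^-1 ->
        `|g (lam t) - f t| < e].

Lemma j1_close_refl e f : 0 < e -> j1_close e f f.
Proof.
move=> e0; exists id; split; first exact: time_change_id.
  by move=> t _; rewrite subrr normr0.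
by move=> t _ _; rewrite subrr normr0.
Qed.

Lemma j1_close_sym e f g : j1_close e f g -> j1_close e g f.
Proof.
move=> [lam [tl lam1 lam2]].
have [mu [tm mulam lammu]] := time_change_inv tl.
exists mu; split => // t t0; have mt0 := time_change_ge0 tm t0.
  by rewrite -{2}[t]lammu// distrC lam1.
by move=> tm1; rewrite -{2}[t]lammu// distrC lam2// lammu//; case: tm1; auto.
Qed.

(** The horizon [e^-1] decreases fast enough to absorb the displacement of the
first time change: for [e + e' < 1] one has [(e + e')^-1 + e <= e'^-1]. *)
Lemma j1_close_trans (e e' : R) f g h : 0 < e -> 0 < e' -> e + e' < 1 ->
  j1_close e f g -> j1_close e' g h -> j1_close (e + e') f h.
Proof.
move=> e0 e'0 ee' [lam [tl lam1 lam2]] [mu [tm mu1 mu2]].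
have hor (a b : R) : 0 < a -> 0 < b -> a + b < 1 -> (a + b)^-1 + a <= b^-1.
  move=> a0 b0 ab; rewrite -subr_ge0.
  have -> : b^-1 - ((a + b)^-1 + a) = a * (1 - b * (a + b)) / (b * (a + b)).
    by field; rewrite !gt_eqF//; lra.
  by rewrite divr_ge0// mulr_ge0//; nra.
have inve : (e + e')^-1 + e <= e'^-1 by exact: hor.
have inve' : (e + e')^-1 + e' <= e^-1.
  by rewrite (addrC e e'); apply: hor => //; lra.
exists (mu \o lam); split; first exact: time_change_comp.
  move=> t t0 /=; have lt0 := time_change_ge0 tl t0.
  rewrite -[mu _ - t](subrKA (lam t)) (le_lt_trans (ler_normD _ _))//.
  by rewrite addrC ltrD ?lam1 ?mu1.
move=> t t0 tT /=; have lt0 := time_change_ge0 tl t0.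
have := lam1 t t0; rewrite ltr_norml => /andP[? ?].
have := mu1 _ lt0; rewrite ltr_norml => /andP[? ?].
rewrite -[h _ - f t](subrKA (g (lam t))) (le_lt_trans (ler_normD _ _))//.
rewrite addrC ltrD ?lam2 ?mu2//; case: tT => /= ?; by [left; lra|right; lra].
Qed.

Lemma j1_close_le (e e' : R) f g : 0 < e -> e <= e' ->
  j1_close e f g -> j1_close e' f g.
Proof.
move=> e0 ee' [lam [tl lam1 lam2]]; exists lam; split => //.
  by move=> t /lam1/lt_le_trans; apply.
have inv : e'^-1 <= e^-1 by rewrite lef_pV2// posrE; lra.
move=> t t0 tT; apply: lt_le_trans ee'; apply: lam2 => //.
by case: tT => /le_trans h; [left|right]; exact: h.
Qed.

Lemma j1_nbh_close (e : R) f g : 0 < e ->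
  j1_nbh f (e^-1 + e) e g -> j1_close e f g.
Proof.
move=> e0 [lam [tl lam1 lam2]]; exists lam; split=> // t t0 tT.
apply: lam2; rewrite t0/=; have := lam1 t t0; rewrite ltr_norml.
by move=> /andP[? ?]; case: tT => ?; lra.
Qed.

Lemma j1_close_nbh (T e d : R) f g : 0 < d -> d <= e -> T <= d^-1 ->
  j1_close d f g -> j1_nbh f T e g.
Proof.
move=> d0 de Td [lam [tl lam1 lam2]]; exists lam; split => // t.
  by move=> /lam1/lt_le_trans; apply.
move=> /andP[t0 tT]; apply: lt_le_trans de.
by apply: lam2 => //; left; exact: le_trans Td.
Qed.

(** The truncation at [1] gives the triangle inequality, since closeness is
additive in its parameter only below [1]. *)
Definition j1_dist f g : R := inf [set e | e = 1 \/ 0 < e /\ j1_close e f g].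

Lemma j1_dist_has_inf f g :
  has_inf [set e | e = 1 \/ 0 < e /\ j1_close e f g].
Proof. by split; [exists 1; left|exists 0 => e [->//|[/ltW]]]. Qed.

Lemma j1_dist_ge0 f g : 0 <= j1_dist f g.
Proof.
by apply: lb_le_inf; [exists 1; left|move=> e [->//|[/ltW]]].
Qed.

Lemma j1_dist_le1 f g : j1_dist f g <= 1.
Proof. by apply: ge_inf; [case: (j1_dist_has_inf f g)|left]. Qed.

Lemma j1_dist_le (e : R) f g : 0 < e -> j1_close e f g -> j1_dist f g <= e.
Proof.
by move=> e0 fg; apply: ge_inf; [case: (j1_dist_has_inf f g)|right].
Qed.

Lemma j1_dist_lt (e : R) f g : e <= 1 -> j1_dist f g < e -> j1_close e f g.
Proof.
move=> e1 /(inf_lt (proj1 (j1_dist_has_inf f g)))[d [->|[d0 fg]] de].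
  by move: e1; rewrite leNgt de.
exact: j1_close_le d0 (ltW de) fg.
Qed.

Lemma j1_dist_sym f g : j1_dist f g = j1_dist g f.
Proof.
by congr inf; apply/seteqP; split=> e [->|[e0 /j1_close_sym]]; by [left|right].
Qed.

Lemma j1_dist_xx f : j1_dist f f = 0.
Proof.
apply/eqP; rewrite eq_le j1_dist_ge0 andbT; apply/ler_addgt0Pr => e e0.
by rewrite add0r j1_dist_le//; exact: j1_close_refl.
Qed.

Lemma j1_dist_triangle f g h : j1_dist f h <= j1_dist f g + j1_dist g h.
Proof.
apply/ler_addgt0Pr => e e0.
have [d1|d1] := leP 1 (j1_dist f g + j1_dist g h + e).
  exact: le_trans (j1_dist_le1 _ _) d1.
have a0 := j1_dist_ge0 f g; have b0 := j1_dist_ge0 g h.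
have fg : j1_close (j1_dist f g + e / 2) f g by apply: j1_dist_lt; lra.
have gh : j1_close (j1_dist g h + e / 2) g h by apply: j1_dist_lt; lra.
rewrite (_ : _ + e = (j1_dist f g + e / 2) + (j1_dist g h + e / 2)); last lra.
by apply: j1_dist_le; last apply: j1_close_trans fg gh; lra.
Qed.

Lemma nbhs_j1_nbh f A : nbhs f A -> exists T e : R, 0 < e /\ j1_nbh f T e `<=` A.
Proof.
rewrite nbhsE => -[B [oB Bf] BA]; have [T [e [e0 sB]]] := oB f Bf.
by exists T, e; split=> // g /sB/BA.
Qed.

Lemma j1_dist_nbh f (T e : R) : 0 < e ->
  exists2 d : R, 0 < d & forall g, j1_dist f g < d -> j1_nbh f T e g.
Proof.
move=> e0; have T1 : 0 < `|T| + 1 by have := normr_ge0 T; lra.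
pose d := Num.min (Num.min e (`|T| + 1)^-1) 1.
have d0 : 0 < d by rewrite !lt_min e0 invr_gt0 T1 ltr01.
exists d => // g /j1_dist_lt fg'.
have fg : j1_close d f g by apply: fg'; rewrite ge_min lexx orbT.
apply: (j1_close_nbh d0 _ _ fg); first by rewrite !ge_min lexx.
apply: (@le_trans _ _ (`|T| + 1)); first by rewrite (le_trans (ler_norm _))// lerDl.
by rewrite -[leLHS]invrK lef_pV2 ?posrE ?invr_gt0// !ge_min lexx orbT.
Qed.

Lemma compatible_j1_dist : compatible_dist j1_dist.
Proof.
split; [exact: j1_dist_xx|exact: j1_dist_sym|exact: j1_dist_triangle|].
move=> f A; split.
  move=> /nbhs_j1_nbh[T [e [/(j1_dist_nbh f T)[d d0 sd] sA]]].
  by exists d => // g /sd/sA.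
move=> [e e0 eA]; rewrite nbhsE; exists [set g | j1_dist f g < e] => //.
split; last by rewrite /= j1_dist_xx.
move=> g /= fg; pose d := (e - j1_dist f g) / 2.
have d0 : 0 < d by rewrite divr_gt0// subr_gt0.
exists (d^-1 + d), d; split=> // h /(j1_nbh_close d0)/(j1_dist_le d0) gh /=.
by apply: le_lt_trans (j1_dist_triangle f g h) _; rewrite /d in gh d0; lra.
Qed.

Lemma j1_nbh_nbhs f (T e : R) : 0 < e -> nbhs f (j1_nbh f T e).
Proof.
move=> /(j1_dist_nbh f T)[d d0 sd].
by have [_ _ _ /(_ f (j1_nbh f T e))->] := compatible_j1_dist; exists d.
Qed.

End j1_distance.

(** * Lipschitz envelopes and Borel maps *)

Section compatible_distance.
Context {R : realType} {S : ptopologicalType} {rho : S -> S -> R}.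
Hypothesis crho : compatible_dist rho.
Implicit Types (F h : S -> R) (x y : S).

Lemma compatible_dist_ge0 x y : 0 <= rho x y.
Proof.
have [r0 rs rt _] := crho.
by have := rt x y x; rewrite r0 (rs y x); lra.
Qed.

Lemma lipschitz_dist_continuous h (k : R) : 0 <= k ->
  (forall x y, h y <= h x + k * rho x y) -> continuous h.
Proof.
move=> k0 hk x; have [_ rs _ rn] := crho; apply/cvgrPdist_lt => e e0.
have k1 : 0 < k + 1 by lra.
apply/rn; exists (e / (k + 1)); first by rewrite divr_gt0.
move=> y; rewrite ltr_pdivlMr// => ry; have := hk x y; have := hk y x.
rewrite (rs y x) ltr_norml; have := compatible_dist_ge0 x y => r0 h1 h2.
by apply/andP; split; nra.
Qed.

(** The Pasch-Hausdorff envelope: the largest [k]-Lipschitz minorant of [F]. *)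
Definition lip_env F (k : R) x : R := inf [set F y + k * rho x y | y in setT].

Section lip_env.
Variables (F : S -> R) (k m : R).
Hypotheses (k0 : 0 <= k) (mF : forall x, m <= F x).

Let lip_env_has_inf x : has_inf [set F y + k * rho x y | y in setT].
Proof.
split; first by exists (F x + k * rho x x), x.
exists m => _ [y _ <-]; rewrite -[m]addr0 lerD// mulr_ge0//.
exact: compatible_dist_ge0.
Qed.

Lemma lip_env_le_point x y : lip_env F k x <= F y + k * rho x y.
Proof. by apply: ge_inf; [case: (lip_env_has_inf x)|exists y]. Qed.

Lemma lip_env_le x : lip_env F k x <= F x.
Proof.
by have := lip_env_le_point x x; have [-> _ _ _] := crho; rewrite mulr0 addr0.
Qed.

Lemma lip_env_ge x (a : R) :
  (forall y, a <= F y + k * rho x y) -> a <= lip_env F k x.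
Proof.
move=> aF; apply: lb_le_inf; first by have [] := lip_env_has_inf x.
by move=> _ [y _ <-]; exact: aF.
Qed.

Lemma lip_env_continuous : continuous (lip_env F k).
Proof.
apply: (lipschitz_dist_continuous k0) => x y; rewrite -lerBlDr.
apply: lip_env_ge => z; rewrite lerBlDr (le_trans (lip_env_le_point _ z))//.
have [_ rs rt _] := crho; rewrite -addrA lerD2l -mulrDr ler_wpM2l//.
by rewrite addrC (rs x y).
Qed.

(** Points at distance at least [e] are made irrelevant by the penalty [k e]. *)
Lemma lip_env_ge_local x (a e : R) : a - m <= k * e ->
  (forall y, rho x y < e -> a <= F y) -> a <= lip_env F k x.
Proof.
move=> ke aF; apply: lip_env_ge => y; have r0 := compatible_dist_ge0 x y.
have [/aF ay|ey] := ltP (rho x y) e; first by rewrite ler_wpDr// mulr_ge0.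
have := mF y; have : k * e <= k * rho x y by rewrite ler_wpM2l.
lra.
Qed.

End lip_env.

Lemma measurable_fun_borelP d (W : measurableType d) (X : W -> S) :
  (forall A, open A -> measurable (X @^-1` A)) ->
  measurable_fun setT (X : W -> borel S).
Proof.
move=> mX; apply: (@measurability _ _ W (borel S) setT X (@open S) erefl).
by move=> _ [A oA <-]; rewrite setTI; exact: mX.
Qed.

Lemma open_borel_measurable (A : set S) : open A -> measurable (A : set (borel S)).
Proof. by move=> oA; exact: sub_sigma_algebra. Qed.

Lemma continuous_borel_measurable h :
  continuous h -> measurable_fun setT (h : borel S -> R).
Proof.
move=> /continuousP ch; apply: (measurability _ (RGenOpens.measurableE R)).
move=> _ [_ [a [b ->] <-]]; rewrite setTI; apply: open_borel_measurable.
exact/ch/interval_open.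
Qed.

(** The open set [A] is the positivity set of a continuous function, the
distance to its complement truncated at [1]; this reduces the claim to
real-valued functions. *)
Lemma measurable_fun_borel_cvg d (W : measurableType d)
    (X_ : nat -> W -> S) (X : W -> S) :
  (forall n, measurable_fun setT (X_ n : W -> borel S)) ->
  (forall w, X_ n w @[n --> \oo] --> X w) ->
  measurable_fun setT (X : W -> borel S).
Proof.
move=> mX_ X_X; apply: measurable_fun_borelP => A oA.
pose F (x : S) : R := (x \in A)%:R.
have F0 x : 0 <= F x by [].
have cphi := lip_env_continuous ler01 F0.
have Aphi : A = [set x | 0 < lip_env F 1 x].
  apply/seteqP; split => [x Ax|x /=].
    have [_ _ _ rn] := crho; have /rn[e e0 eA] := open_nbhs_nbhs (conj oA Ax).
    rewrite /=; apply: (@lt_le_trans _ _ (Num.min 1 e)).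
      by rewrite lt_min ltr01.
    apply: (lip_env_ge_local ler01 F0 (e := e)).
      by rewrite subr0 mul1r ge_min lexx orbT.
    by move=> y /eA Ay; rewrite /F mem_set// ge_min lexx.
  apply: contraPP => nAx; apply/negP; rewrite -leNgt.
  by rewrite (le_trans (lip_env_le ler01 F0 x))// /F memNset.
have mphi : measurable_fun setT (lip_env F 1 \o X).
  apply: (measurable_fun_cvg
            (h := fun n => lip_env F 1 \o X_ n)).
    move=> n; exact: (measurableT_comp (continuous_borel_measurable cphi)).
  by move=> w _; apply: (continuous_cvg _ (cphi (X w))).
rewrite (_ : _ @^-1` A = (lip_env F 1 \o X) @^-1` `]0, +oo[%classic).
  by rewrite -[X in measurable X]setTI; exact: mphi.
by rewrite {1}Aphi; apply/seteqP; split=> w /=; rewrite in_itv/= andbT.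
Qed.

End compatible_distance.

(** * The continuous mapping theorem for varying maps *)

Section bounded_random_variables.
Context {R : realType}.

Lemma bounded_integrable d (W : measurableType d) (P : probability W R)
    (X : W -> R) (M : R) :
  measurable_fun setT X -> (forall w, `|X w| <= M) ->
  P.-integrable setT (EFin \o X).
Proof.
move=> mX XM; apply: measurable_bounded_integrable => //.
  exact: le_lt_trans (probability_le1 P measurableT) (ltry 1).
exists M; split; first exact: num_real.
by move=> N MN w _; exact: le_trans (XM w) (ltW MN).
Qed.

Lemma bounded_fun_normP (T : Type) (f : T -> R) :
  bounded_fun f <-> exists M, forall x, `|f x| <= M.
Proof.
split=> [[M [Mr fM]]|[M fM]].
  by exists (M + 1) => x; apply: fM => //; rewrite ltrDl.
exists M; split; first exact: num_real.
by move=> N MN x _; exact: le_trans (fM x) (ltW MN).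
Qed.

Lemma Rintegral_distribution d d' (W : measurableType d)
    (T : measurableType d') (P : probability W R) (X : {mfun W >-> T})
    (f : T -> R) (M : R) :
  measurable_fun setT f -> (forall x, `|f x| <= M) ->
  \int[distribution P X]_x f x = \int[P]_w f (X w).
Proof.
move=> mf fM; congr fine; rewrite (@integral_distribution _ _ _ _ _ P X)//.
  exact/measurable_EFinP.
apply: (@bounded_integrable _ _ _ (f \o X) M).
  exact: measurableT_comp.
by move=> w; exact: fM.
Qed.

Lemma bounded_convergence d (W : measurableType d) (P : probability W R)
    (X_ : nat -> W -> R) (X : W -> R) (M : R) :
  (forall n, measurable_fun setT (X_ n)) -> measurable_fun setT X ->
  (forall n w, `|X_ n w| <= M) ->
  {ae P, forall w, X_ n w @[n --> \oo] --> X w} ->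
  \int[P]_w X_ n w @[n --> \oo] --> \int[P]_w X w.
Proof.
move=> mX_ mX X_M X_X.
have iM : P.-integrable setT (cst M%:E).
  exact: (@bounded_integrable _ _ P (cst M) `|M|).
have [||||iX _ cvgX] := @dominated_convergence _ W R P setT measurableT
  (fun n => EFin \o X_ n) (EFin \o X) (cst M%:E) _ _ _ iM.
- by move=> n; exact/measurable_EFinP.
- exact/measurable_EFinP.
- by apply: filterS X_X => w Xw _; apply: cvg_EFin => //; exact: nearW.
- by apply: aeW => w n _ /=; rewrite lee_fin.
by apply: fine_cvg; rewrite fineK//; exact: integrable_fin_num.
Qed.

End bounded_random_variables.

Section extended_continuous_mapping.
Context {R : realType} {S S' : ptopologicalType} {rho : S -> S -> R}.
Hypothesis crho : compatible_dist rho.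
Context {disp : measure_display} {W : measurableType disp} (P : probability W R).
Context {disp_ : nat -> measure_display}
  {W_ : forall n, measurableType (disp_ n)} (P_ : forall n, probability (W_ n) R).
Variables (X_ : forall n, {mfun W_ n >-> borel S}) (X : {mfun W >-> borel S}).
Variables (Psi_ : nat -> S -> S') (Psi : S -> S').
Hypothesis X_cvg :
  weak_cvg (fun n => distribution (P_ n) (X_ n)) (distribution P X).
Hypothesis mPsi_ : forall n,
  measurable_fun setT (Psi_ n \o X_ n : W_ n -> borel S').
Hypothesis mPsi : measurable_fun setT (Psi \o X : W -> borel S').
Hypothesis Psi_cvg : {ae P, forall w,
  Psi_ p.1 p.2 @[p --> (\oo, nbhs (X w : S))] --> Psi (X w)}.

(** The functions [g \o Psi_ n] need not be continuous, so weak convergence is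
applied to minorants.  Let [H k] be the [k]-Lipschitz envelope of the infimum
of the [g \o Psi_ n] over [n >= k].  It is continuous and at most
[g \o Psi_ n] for [n >= k], so that the expectations of [g (Psi_ n (X_ n))] are
asymptotically at least that of [H k X].  At a point where [Psi_] converges
continuously, [H k] is eventually at least [g \o Psi] up to any error, because
the penalty [k * rho] makes only near points count; bounded convergence then
lets [k] tend to infinity. *)
Lemma extended_mapping_lower_bound (g : S' -> R) (M e : R) :
  continuous g -> (forall x, `|g x| <= M) -> 0 < e ->
  \forall n \near \oo,
    \int[P]_w g (Psi (X w)) - e <= \int[P_ n]_w g (Psi_ n (X_ n w)).
Proof.
move=> cg gM e0.
pose F k x := inf [set g (Psi_ n x) | n in [set n | (k <= n)%N]].
have F_inf k x : has_inf [set g (Psi_ n x) | n in [set n | (k <= n)%N]].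
  split; first by exists (g (Psi_ k x)), k => /=.
  by exists (- M) => _ [n _ <-]; have := gM (Psi_ n x); rewrite ler_norml => /andP[].
have F_ge k x a : (forall n, (k <= n)%N -> a <= g (Psi_ n x)) -> a <= F k x.
  move=> aF; apply: lb_le_inf; first by case: (F_inf k x).
  by move=> _ [n kn <-]; exact: aF.
have F_le k n x : (k <= n)%N -> F k x <= g (Psi_ n x).
  by move=> kn; apply: ge_inf; [case: (F_inf k x)|exists n].
have gNM x : - M <= g x by have := gM x; rewrite ler_norml => /andP[].
have FNM k x : - M <= F k x by exact: F_ge.
have M0 : 0 <= M by rewrite (le_trans _ (gM point)).
pose H (k : nat) := lip_env (rho := rho) (F k) k%:R.
have k0 k : (0 : R) <= k%:R by [].
have cH k : continuous (H k) by exact: lip_env_continuous crho _ _ _ (k0 k) (FNM k).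
have HM k x : `|H k x| <= M.
  rewrite ler_norml; apply/andP; split.
    apply: (lip_env_ge crho (k0 k) (FNM k)) => y.
    by rewrite ler_wpDr// mulr_ge0//; exact: compatible_dist_ge0 crho _ _.
  apply: le_trans (lip_env_le crho (k0 k) (FNM k) x) _.
  apply: le_trans (F_le _ k _ (leqnn k)) _.
  by have := gM (Psi_ k x); rewrite ler_norml => /andP[].
have mH k : measurable_fun setT (H k : borel S -> R).
  exact: continuous_borel_measurable (cH k).
have mHX k : measurable_fun setT (fun w => H k (X w)).
  exact: measurableT_comp (mH k) _.
have mHX_ k n : measurable_fun setT (fun w => H k (X_ n w)).
  exact: measurableT_comp (mH k) _.
have mg : measurable_fun setT (g : borel S' -> R).
  exact: continuous_borel_measurable.
have mG : measurable_fun setT (fun w => g (Psi (X w))).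
  exact: measurableT_comp mg mPsi.
have mG_ n : measurable_fun setT (g \o (Psi_ n \o X_ n)).
  by apply: measurableT_comp mg _; exact: mPsi_.
(* [H k] may exceed [g \o Psi], which the truncation removes. *)
pose m k w := Num.min (H k (X w)) (g (Psi (X w))).
have mm k : measurable_fun setT (m k) by exact: measurable_minr.
have mM k w : `|m k w| <= M.
  by rewrite /m; case: (leP (H k (X w))) => _.
have m_cvg : {ae P, forall w, m k w @[k --> \oo] --> g (Psi (X w))}.
  apply: filterS Psi_cvg => w Psiw; apply/cvgrPdist_le => a a0.
  have : \forall p \near (\oo, nbhs (X w : S)),
      g (Psi (X w)) - a <= g (Psi_ p.1 p.2).
    have /cvgrPdist_le/(_ _ a0) := cvg_comp _ _ Psiw (cg (Psi (X w))).
    by apply: filterS => p; rewrite /= ler_norml lerBlDr -lerBlDl => /andP[_].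
  move=> [[A B] /= [[N _ NA] BX] AB].
  have [_ _ _ rn] := crho; have [d d0 dB] := (rn _ _).1 BX.
  have ND : \forall k \near \oo, 2 * M / d <= k%:R.
    exact: nbhs_infty_ger.
  near=> k.
  have Hk : g (Psi (X w)) - a <= H k (X w).
    apply: (lip_env_ge_local crho (k0 k) (FNM k) (e := d)).
      rewrite opprK; apply: (@le_trans _ _ (2 * M)).
        have := gM (Psi (X w)); rewrite ler_norml => /andP[_ ?]; lra.
      by rewrite -ler_pdivrMr//; near: k.
    move=> y /dB By; apply: F_ge => n kn; apply: (AB (n, y)); split => //=.
    by apply: NA; rewrite /= (leq_trans _ kn)//; near: k; exact: nbhs_infty_ge.
  rewrite /m ger0_norm ?subr_ge0 ?ge_min ?lexx ?orbT// /Num.min.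
  by case: ifP => _; [move: Hk; rewrite lerBlDr -lerBlDl|rewrite subrr ltW].
have /cvgrPdist_le/(_ (e / 2)) := bounded_convergence mm mG mM m_cvg.
move=> /(_ ltac:(lra))[k _ /(_ k (leqnn k))].
rewrite ler_norml => /andP[_ mk].
have iH : \int[P]_w m k w <= \int[P]_w H k (X w).
  apply: le_Rintegral => //.
  - exact: bounded_integrable (mm k) (mM k).
  - exact: bounded_integrable (mHX k) (fun w => HM k (X w)).
  - by move=> w _; rewrite /m ge_min lexx.
have bH : bounded_fun (H k) by apply/bounded_fun_normP; exists M.
have /cvgrPdist_le/(_ (e / 2)) := X_cvg (cH k) bH.
move=> /(_ ltac:(lra)) Hcvg; near=> n.
have : `|\int[distribution P X]_x H k x -
         \int[distribution (P_ n) (X_ n)]_x H k x| <= e / 2 by near: n.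
rewrite !(Rintegral_distribution _ _ (mH k) (HM k)) ler_norml => /andP[_ Hn].
have iG : \int[P_ n]_w H k (X_ n w) <= \int[P_ n]_w g (Psi_ n (X_ n w)).
  apply: le_Rintegral => //.
  - exact: bounded_integrable (mHX_ k n) (fun w => HM k (X_ n w)).
  - exact: bounded_integrable (mG_ n) (fun w => gM _).
  - move=> w _; apply: le_trans (lip_env_le crho (k0 k) (FNM k) _) _.
    by apply: F_le; near: n; exact: nbhs_infty_ge.
lra.
Unshelve. all: by end_near. Qed.

(** The lower bounds for [g] and for [- g] together give convergence. *)
Lemma extended_mapping_weak_cvg (Y_ : forall n, {mfun W_ n >-> borel S'})
    (Y : {mfun W >-> borel S'}) :
  (forall n w, Y_ n w = Psi_ n (X_ n w)) -> (forall w, Y w = Psi (X w)) ->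
  weak_cvg (fun n => distribution (P_ n) (Y_ n)) (distribution P Y).
Proof.
move=> Y_E YE g cg /bounded_fun_normP[M gM].
have mg : measurable_fun setT (g : borel S' -> R).
  exact: continuous_borel_measurable.
have gYE : \int[distribution P Y]_x g x = \int[P]_w g (Psi (X w)).
  by rewrite (Rintegral_distribution _ _ mg gM); under eq_Rintegral do rewrite YE.
have gY_E n : \int[distribution (P_ n) (Y_ n)]_x g x =
    \int[P_ n]_w g (Psi_ n (X_ n w)).
  by rewrite (Rintegral_distribution _ _ mg gM); under eq_Rintegral do rewrite Y_E.
have intN d (T : measurableType d) (Q : probability T R) (Z : {mfun T >-> borel S'}) :
    \int[Q]_w (- g (Z w)) = - \int[Q]_w g (Z w).
  under eq_Rintegral do rewrite -mulN1r.
  rewrite RintegralZl ?mulN1r//.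
  by apply: bounded_integrable (fun w => gM _); exact: measurableT_comp mg _.
apply/cvgrPdist_le => e e0.
have gNM x : `|- g x| <= M by rewrite normrN.
have cNg : continuous (- g) by move=> x; apply: cvgN; exact: cg.
have L := extended_mapping_lower_bound cg gM e0.
have U := extended_mapping_lower_bound cNg gNM e0.
near=> n; rewrite ler_norml; apply/andP; split.
  have : \int[P]_w (- g (Psi (X w))) - e <= \int[P_ n]_w (- g (Psi_ n (X_ n w))).
    by near: n.
  under eq_Rintegral do rewrite -YE.
  under [leRHS]eq_Rintegral do rewrite -Y_E.
  rewrite !intN.
  under eq_Rintegral do rewrite YE.
  under [X in _ <= - X]eq_Rintegral do rewrite Y_E.
  by rewrite -gYE -gY_E; lra.
have : \int[P]_w g (Psi (X w)) - e <= \int[P_ n]_w g (Psi_ n (X_ n w)).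
  by near: n.
by rewrite -gYE -gY_E; lra.
Unshelve. all: by end_near. Qed.

End extended_continuous_mapping.

(** * Norms of matrices, real induction and grids *)

Section matrix_norm.
Context {R : realType} {m n : nat}.

Lemma mx_norm_le (x : 'M[R]_(m, n)) (c : R) : 0 <= c ->
  (forall i j, `|x i j| <= c) -> `|x| <= c.
Proof.
move=> c0 xc; rewrite -[`|x|]/(mx_norm x) mx_normrE.
by apply: bigmax_le => // -[i j] _; exact: xc.
Qed.

Lemma mx_norm_ge (x : 'M[R]_(m, n)) i j : `|x i j| <= `|x|.
Proof.
rewrite -[`|x|]/(mx_norm x) mx_normrE.
exact: (le_bigmax _ (fun p : 'I_m * 'I_n => `|x p.1 p.2|) (i, j)).
Qed.

End matrix_norm.

(** Real induction: the times up to which [P] holds form an initial segment of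
the half-line, which the two steps prevent from ending. *)
Lemma real_induction {R : realType} (P : R -> Prop) : P 0 ->
  (forall u, 0 <= u -> P u ->
     exists2 v, u < v & forall w, u < w -> w < v -> P w) ->
  (forall v, 0 < v -> exists2 u, u < v &
     forall w, 0 <= w -> u < w -> w < v -> P w -> P v) ->
  forall t, 0 <= t -> P t.
Proof.
move=> P0 Pright Pleft t t0.
pose S := [set x | 0 <= x <= t /\ forall y, 0 <= y <= x -> P y].
have S0 : S 0.
  split; first by rewrite lexx.
  by move=> y y0; have -> : y = 0 by apply/eqP; rewrite eq_le andbC.
have supS : has_sup S by split; [exists 0|exists t => x [/andP[]]].
have c0 : 0 <= sup S by exact: sup_upper_bound.
have ct : sup S <= t by apply: ge_sup; [exists 0|move=> x [/andP[]]].
have PltS y : 0 <= y -> y < sup S -> P y.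
  move=> y0 /(sup_gt (proj1 supS))[x [_ Sx] yx].
  by apply: Sx; rewrite y0 ltW.
have PS : P (sup S).
  have [->//|cn0] := eqVneq (sup S) 0.
  have {}cn0 : 0 < sup S by rewrite lt_neqAle eq_sym cn0.
  have [u us Pu] := Pleft _ cn0.
  pose w := (Num.max u 0 + sup S) / 2.
  have mS : Num.max u 0 < sup S by rewrite gt_max us.
  have um : u <= Num.max u 0 by rewrite le_max lexx.
  have om : 0 <= Num.max u 0 by rewrite le_max lexx orbT.
  apply: (Pu w); rewrite /w; [lra|lra|lra|].
  by apply: PltS; lra.
have PleS y : 0 <= y -> y <= sup S -> P y.
  by move=> y0; rewrite le_eqVlt => /predU1P[->//|]; exact: PltS.
have [->//|ctn] := eqVneq t (sup S).
have {}ct : sup S < t by rewrite lt_neqAle eq_sym ctn.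
have [v cv Pv] := Pright _ c0 PS.
pose w := (sup S + Num.min v t) / 2.
have cm : sup S < Num.min v t by rewrite lt_min cv.
have mv : Num.min v t <= v by rewrite ge_min lexx.
have mt : Num.min v t <= t by rewrite ge_min lexx orbT.
suff /(sup_upper_bound supS) : S w by rewrite /w; lra.
split; first by apply/andP; split; rewrite /w; lra.
move=> y /andP[y0 yw]; have [yc|cy] := leP y (sup S); first exact: PleS.
by apply: Pv => //; move: yw; rewrite /w; lra.
Qed.

Section discretization.
Context {R : realType}.
Implicit Types (f : R -> R).

Lemma grid_le (n : nat) (t : R) : grid n.+1 t <= t.
Proof.
have /andP[f1 _] := floor_itv (n.+1%:R * t).
by rewrite /grid ler_pdivrMr ?ltr0n// [t * _]mulrC.
Qed.

Lemma grid_gt (n : nat) (t : R) : t - n.+1%:R^-1 < grid n.+1 t.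
Proof.
have /andP[_ f2] := floor_itv (n.+1%:R * t).
rewrite rmorphD/= in f2.
by rewrite /grid ltrBlDr -[X in _ + X]mul1r -mulrDl ltr_pdivlMr ?ltr0n// [t * _]mulrC.
Qed.

Lemma grid_ge0 (n : nat) (t : R) : 0 <= t -> 0 <= grid n t.
Proof.
by move=> t0; rewrite /grid divr_ge0// ler0z floor_ge0 mulr_ge0.
Qed.

Definition ceil_grid (n : nat) (t : R) : R := (Num.ceil (n%:R * t))%:~R / n%:R.

Lemma ceil_grid_ge (n : nat) (t : R) : t <= ceil_grid n.+1 t.
Proof.
by rewrite /ceil_grid ler_pdivlMr ?ltr0n// [t * _]mulrC ceil_ge.
Qed.

Lemma ceil_grid_lt (n : nat) (t : R) : ceil_grid n.+1 t < t + n.+1%:R^-1.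
Proof.
have /andP[f1 _] := ceil_itv (n.+1%:R * t).
rewrite rmorphB/= in f1.
by rewrite /ceil_grid -ltrBlDr -[X in _ - X]mul1r -mulrBl ltr_pdivrMr ?ltr0n// [t * _]mulrC.
Qed.

Lemma grid_ge_ceil (n : nat) (u t : R) :
  ceil_grid n.+1 u <= t -> u <= grid n.+1 t.
Proof.
rewrite /ceil_grid /grid ler_pdivrMr ?ltr0n// ler_pdivlMr ?ltr0n// => ut.
apply: le_trans (_ : (Num.ceil (n.+1%:R * u))%:~R <= _).
  by rewrite [u * _]mulrC ceil_ge.
by rewrite ler_int floor_ge_int [_ * t]mulrC.
Qed.

Lemma grid_lt_ceil (n : nat) (v t : R) :
  t < ceil_grid n.+1 v -> grid n.+1 t < v.
Proof.
rewrite /ceil_grid /grid ltr_pdivlMr ?ltr0n// ltr_pdivrMr ?ltr0n// => tv.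
have /andP[f1 _] := ceil_itv (n.+1%:R * v).
apply: le_lt_trans (_ : (Num.ceil (n.+1%:R * v) - 1)%:~R < _); last by rewrite [v * _]mulrC.
rewrite ler_int lerBrDr -ltzD1 ltrD2r -(ltr_int R).
apply: le_lt_trans tv; rewrite [t * _]mulrC.
by have /andP[] := floor_itv (n.+1%:R * t).
Qed.

End discretization.

(** * Aligning a cadlag path with a grid *)

Section grid_approximation.
Context {R : realType} {V : normedModType R}.
Variables (f : R -> V) (e : R).
Hypotheses (cf : cadlag f) (e0 : 0 < e).

Definition small_osc (u v : R) : Prop :=
  forall s t, u <= s < v -> u <= t < v -> `|f s - f t| < e.

Let osc_of_cvg (F : set_system R) (l : V) : Filter F -> f x @[x --> F] --> l ->
  \forall x \near F, `|l - f x| < e / 2.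
Proof. by move=> FF /cvgrPdist_lt; apply; rewrite divr_gt0. Qed.

Let dist_half (l a b : V) :
  `|l - a| < e / 2 -> `|l - b| < e / 2 -> `|a - b| < e.
Proof.
move=> la lb; rewrite -[a - b](subrKA l) (splitr e).
by rewrite (le_lt_trans (ler_normD _ _))// ltrD// distrC.
Qed.

Lemma small_osc_right u : 0 <= u -> exists2 v, u < v & small_osc u v.
Proof.
move=> u0; have := osc_of_cvg (@at_right_proper_filter R u) (cf.1 u u0).
rewrite /prop_near1 /at_right /within/= => /nbhs_ballP[d d0 ud].
exists (u + d); first by rewrite ltrDl.
have fu x : u <= x < u + d -> `|f u - f x| < e / 2.
  move=> /andP[ux xd]; have [<-|nux] := eqVneq u x.
    by rewrite subrr normr0 divr_gt0.
  apply: ud; last by rewrite lt_neqAle nux.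
  by rewrite -ball_normE/= distrC ger0_norm ?subr_ge0// ltrBlDl.
by move=> s t /fu us /fu; exact: dist_half.
Qed.

Lemma small_osc_left v : 0 < v -> exists2 u, u < v & forall w, u < w -> small_osc w v.
Proof.
move=> v0; have [l fl] := cf.2 v v0; have := osc_of_cvg (@at_left_proper_filter R v) fl.
rewrite /prop_near1 /at_left /within/= => /nbhs_ballP[d d0 vd].
exists (v - d); first by rewrite gtrBl.
have fv w x : v - d < w -> w <= x < v -> `|l - f x| < e / 2.
  move=> dw /andP[wx xv]; apply: vd => //.
  rewrite -ball_normE/= ger0_norm ?subr_ge0 ?(ltW xv)//.
  by rewrite ltrBlDr -ltrBlDl (lt_le_trans dw).
by move=> w dw s t /fv-/(_ dw) ws /fv-/(_ dw); exact: dist_half.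
Qed.

(** On [0, u[ the path [f] is [e]-close, after the time change, to the path that
is constant between grid points.  The time change sends [u] itself to the grid,
which lets the construction be continued from [u]. *)
Definition grid_aligned (n : nat) (u : R) (kappa : R -> R) : Prop :=
  [/\ time_change kappa,
      forall t, 0 <= t -> `|kappa t - t| <= n.+1%:R^-1,
      kappa u = ceil_grid n.+1 u &
      forall t, 0 <= t < u -> `|f (grid n.+1 (kappa t)) - f t| < e].

Let gt_stretch (a b x : R) : 0 < a -> 0 < x ->
  exists2 th : R, 0 < th <= 1 & stretch a b x = x + th * (b - a) /\
                              (x < a -> stretch a b x = th * b).
Proof.
move=> a0 x0; have an0 : a != 0 by rewrite gt_eqF.
rewrite /stretch /glue; have [xa|ax] := leP x a.
  exists (x / a); first by rewrite divr_gt0// ler_pdivrMr// mul1r.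
  by split=> [|_]; field.
exists 1; first by rewrite ltr01 lexx.
by split=> [|ax']; [field|move: ax; rewrite ltNge (ltW ax')].
Qed.

(** The interval [u, v[ is stretched linearly so that its endpoints land on the
grid.  A grid cell that meets the image then starts inside it, so that the
discretized path only takes values that [f] takes on [u, v[; the displacement
interpolates between its values at the endpoints and stays below one grid
step. *)
Lemma grid_aligned_extend (n : nat) (u v : R) kappa :
  0 <= u -> u + n.+1%:R^-1 < v -> small_osc u v -> grid_aligned n u kappa ->
  exists kappa', grid_aligned n v kappa'.
Proof.
move=> u0 uv osc [tk kid ku kf]; set d := n.+1%:R^-1 in kid uv *.
have n0 : 0 < d by rewrite invr_gt0 ltr0n.
pose su := ceil_grid n.+1 u; pose sv := ceil_grid n.+1 v.
have su1 : u <= su by exact: ceil_grid_ge.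
have su2 : su < u + d by exact: ceil_grid_lt.
have sv1 : v <= sv by exact: ceil_grid_ge.
have sv2 : sv < v + d by exact: ceil_grid_lt.
have uv0 : 0 < v - u by lra.
have suv0 : 0 < sv - su by lra.
have st := time_change_stretch uv0 suv0.
have st0 : stretch (v - u) (sv - su) 0 = 0 by have [] := st.
have stv : stretch (v - u) (sv - su) (v - u) = sv - su.
  by rewrite /stretch /glue lexx mulrC divfK// gt_eqF.
pose kap := glue u kappa (stretch (v - u) (sv - su)).
have kapE t : u <= t -> kap t = su + stretch (v - u) (sv - su) (t - u).
  rewrite le_eqVlt => /predU1P[<-|ut].
    by rewrite /kap/glue lexx subrr st0 addr0 ku.
  by rewrite /kap/glue leNgt ut/= ku.
exists kap; split.
- exact: time_change_glue.
- move=> t t0; have [tu|ut] := leP t u; first by rewrite /kap/glue tu kid.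
  rewrite (kapE _ (ltW ut)).
  have [|th /andP[th0 th1] [-> _]] := gt_stretch (sv - su) uv0 (_ : 0 < t - u).
    by rewrite subr_gt0.
  have -> : su + (t - u + th * (sv - su - (v - u))) - t =
      (1 - th) * (su - u) + th * (sv - v) by ring.
  rewrite ger0_norm; last by rewrite addr_ge0// mulr_ge0//; lra.
  rewrite -/d (_ : d = (1 - th) * d + th * d); last by ring.
  by rewrite lerD// ler_wpM2l//; lra.
- by rewrite kapE ?stv ?subrKC//; lra.
- move=> t /andP[t0 tv]; have [tu|ut] := ltP t u.
    by rewrite /kap/glue (ltW tu) kf// t0.
  have k1 : su <= kap t.
    rewrite kapE// lerDl time_change_ge0//; lra.
  have k2 : kap t < sv.
    have [_ stlt _ _] := st; rewrite kapE// -ltrBrDl -[X in _ < X]stv.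
    by apply: stlt; rewrite ?in_itv/= ?andbT; lra.
  apply: osc; first by rewrite grid_ge_ceil//= grid_lt_ceil.
  by rewrite ut tv.
Qed.

(** Real induction on the time up to which the alignment succeeds: right
continuity carries it past any time, the existence of left limits up to any
time. *)
Lemma grid_aligned_near (t : R) : 0 <= t ->
  \forall n \near \oo, exists kappa, grid_aligned n t kappa.
Proof.
have extend u v : 0 <= u -> u < v -> small_osc u v ->
    (\forall n \near \oo, exists kappa, grid_aligned n u kappa) ->
    \forall n \near \oo, exists kappa, grid_aligned n v kappa.
  move=> u0 uv osc Hu; have vu : 0 < v - u by rewrite subr_gt0.
  near=> n; have [kappa Hk] : exists kappa, grid_aligned n u kappa by near: n.
  apply: grid_aligned_extend osc Hk => //.
  rewrite -ltrBrDl; near: n; exact: (near_infty_natSinv_lt (PosNum vu)).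
apply: (real_induction (P := fun t : R =>
  \forall n \near \oo, exists kappa, grid_aligned n t kappa)).
- apply: nearW => n; exists id; split.
  + exact: time_change_id.
  + by move=> s _; rewrite subrr normr0.
  + by rewrite /ceil_grid mulr0 ceil0 mul0r.
  + by move=> s /andP[s0 /(le_lt_trans s0)]; rewrite ltxx.
- move=> u u0 Pu; have [v uv osc] := small_osc_right u0; exists v => // w uw wv.
  apply: extend Pu => // s r /andP[us sw] /andP[ur rw].
  by apply: osc; rewrite ?us ?ur (lt_trans _ wv).
- move=> v v0; have [u uv osc] := small_osc_left v0; exists u => // w w0 uw wv.
  by apply: extend => //; exact: osc.
Unshelve. all: by end_near. Qed.

End grid_approximation.

(** * Processes are Borel maps into the path space *)

Section step_paths.
Context {R : realType} {q : nat}.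

(** The values at the grid points of [0, n + 1], in units of the grid step; the
range of the code is countable. *)
Definition step_code (n : nat) : countType :=
  {ffun 'I_(n.+1 * n.+1).+1 * 'I_q -> int}.

(** Past the horizon the default value of [inord] applies; convergence in the J1
topology only looks at times up to the horizon. *)
Definition step_value (n : nat) (c : step_code n) (t : R) : 'cV[R]_q :=
  if t < 0 then 0 else
  \col_i ((c (inord `|Num.floor (n.+1%:R * t)|%N, i))%:~R / n.+1%:R).

Let step_neg (n : nat) (c : step_code n) (t : R) :
  t < 0 -> step_value c (grid n.+1 t) = 0.
Proof.
by move=> t0; rewrite /step_value (le_lt_trans (grid_le n t)).
Qed.

Definition step_path (n : nat) (c : step_code n) : skorokhod R q :=
  Skorokhod (@step_neg n c) (cadlag_floor (step_value c) n.+1).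

Definition quantize (n : nat) (f : R -> 'cV[R]_q) : step_code n :=
  [ffun p : 'I_(n.+1 * n.+1).+1 * 'I_q =>
     Num.floor (n.+1%:R * f (p.1%:R / n.+1%:R) p.2 0)].

Lemma step_path_quantize (n : nat) (f : R -> 'cV[R]_q) (t : R) :
  0 <= t <= n.+1%:R ->
  `|step_path (quantize n f) t - f (grid n.+1 t)| <= n.+1%:R^-1.
Proof.
move=> /andP[t0 tn]; have n0 : (0 : R) < n.+1%:R by rewrite ltr0n.
have g0 := grid_ge0 n.+1 t0; rewrite /= /step_value -/(grid n.+1 t) ltNge g0/=.
have fl0 : 0 <= Num.floor (n.+1%:R * t) by rewrite floor_ge0 mulr_ge0// ltW.
have -> : Num.floor (n.+1%:R * grid n.+1 t) = Num.floor (n.+1%:R * t).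
  by rewrite /grid mulrC divfK ?gt_eqF// intrKfloor.
set j := `|Num.floor (n.+1%:R * t)|%N.
have jE : j%:R = (Num.floor (n.+1%:R * t))%:~R :> R by rewrite natr_absz ger0_norm.
have jn : (j < (n.+1 * n.+1).+1)%N.
  rewrite ltnS -(ler_nat R) natrM jE.
  have /andP[+ _] := floor_itv (n.+1%:R * t); move/le_trans; apply.
  by rewrite ler_pM2l.
apply: mx_norm_le => [|i k]; first by rewrite invr_ge0 ltW.
rewrite !mxE ord1 /quantize ffunE/= inordK// jE -/(grid n.+1 t).
set x := f _ i 0; have /andP[x1 x2] := floor_itv (n.+1%:R * x).
rewrite rmorphD/= in x2.
have -> : (Num.floor (n.+1%:R * x))%:~R / n.+1%:R - x =
    - ((n.+1%:R * x - (Num.floor (n.+1%:R * x))%:~R) / n.+1%:R).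
  by field; rewrite addrC natr1 gt_eqF.
rewrite normrN normrM normfV (gtr0_norm n0) ler_piMl ?invr_ge0 ?(ltW n0)//.
by rewrite ger0_norm; lra.
Qed.

Lemma step_path_cvg (f : skorokhod R q) :
  step_path (quantize n f) @[n --> \oo] --> f.
Proof.
move=> A /nbhs_j1_nbh[T [e [e0 sA]]].
have e20 : 0 < e / 2 by rewrite divr_gt0.
pose T1 := Num.max T 0 + 1.
have mT : T <= Num.max T 0 by rewrite le_max lexx.
have m0 : 0 <= Num.max T 0 by rewrite le_max lexx orbT.
have T10 : 0 <= T1 by rewrite /T1; lra.
have aligned := grid_aligned_near (path_cadlag f) e20 T10.
suff : \forall n \near \oo, j1_nbh f T e (step_path (quantize n f)).
  by apply: filterS => n /sA.
near=> n.
have n1 : n.+1%:R^-1 <= 1 :> R by rewrite invf_le1 ?ltr0n// ler1n.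
have ne : n.+1%:R^-1 < e / 2 by near: n; exact: (near_infty_natSinv_lt (PosNum e20)).
have Tn : T + 1 <= n.+1%:R.
  apply: (@le_trans _ _ n%:R); last by rewrite ler_nat.
  by near: n; exact: nbhs_infty_ger.
have [kappa [tk kid _ kf]] : exists kappa, grid_aligned f (e / 2) n T1 kappa.
  by near: n.
exists kappa; split=> [//|t t0|t /andP[t0 tT]].
  apply: le_lt_trans (kid t t0) (lt_le_trans ne _); lra.
have := kid t t0; rewrite ler_norml => /andP[_ /le_trans/(_ n1) kt].
have kn : 0 <= kappa t <= n.+1%:R.
  by rewrite time_change_ge0//=; lra.
rewrite -[_ - f t](subrKA (f (grid n.+1 (kappa t)))) (splitr e).
rewrite (le_lt_trans (ler_normD _ _))// ltrD//.
  by rewrite (le_lt_trans (step_path_quantize f kn)).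
by apply: kf; rewrite t0/= /T1; lra.
Unshelve. all: by end_near. Qed.

(** The preimage of any set is a countable union of events on which the code is
given, and the code is a function of finitely many coordinates. *)
Lemma measurable_step_quantize d (W : measurableType d) (X : W -> skorokhod R q)
    (n : nat) : is_process X ->
  measurable_fun setT ((fun w => step_path (quantize n (X w))) : W -> borel (skorokhod R q)).
Proof.
move=> pX; apply: measurable_fun_borelP => A _.
rewrite (_ : _ @^-1` A = \bigcup_(c : step_code n)
    ([set _ | A (step_path c)] `&` [set w | quantize n (X w) = c])); last first.
  apply/seteqP; split=> w /=; first by move=> Aw; exists (quantize n (X w)).
  by move=> [c _ [Ac ->]].
apply: countable_bigcupT_measurable => [|c]; first exact: countableP.
apply: measurableI.
  by have [Ac|nAc] := pselect (A (step_path c));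
     [rewrite (_ : [set _ | _] = setT)|rewrite (_ : [set _ | _] = set0)] => //;
     apply/seteqP; split.
rewrite (_ : [set w | _] = \bigcap_(p in [set: 'I_(n.+1 * n.+1).+1 * 'I_q])
    [set w | Num.floor (n.+1%:R * X w (p.1%:R / n.+1%:R) p.2 0) = c p]); last first.
  apply/seteqP; split=> w /= => [<- p _ /=|Xw]; first by rewrite ffunE.
  by apply/ffunP => p; rewrite ffunE; exact: Xw.
apply: fin_bigcap_measurable => [|[j i] _ /=]; first exact: finite_finset.
have mXji : measurable_fun setT (fun w => n.+1%:R * X w (j%:R / n.+1%:R) i 0).
  by apply: measurable_funM => //; apply: pX; rewrite divr_ge0.
rewrite (_ : [set w | _] = (fun w => n.+1%:R * X w (j%:R / n.+1%:R) i 0) @^-1`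
    `[(c (j, i))%:~R, (c (j, i) + 1)%:~R[%classic); last first.
  apply/seteqP; split=> w /=; rewrite in_itv/=; last exact: floor_def.
  by move=> <-; exact: floor_itv.
by rewrite -[X in measurable X]setTI; exact: mXji.
Qed.

(** The half of the equality between the Borel and the cylinder sigma-algebra of
D that is needed for maps such as [Phin n], which are not J1 continuous. *)
Lemma measurable_process d (W : measurableType d) (X : W -> skorokhod R q) :
  is_process X -> measurable_fun setT (X : W -> borel (skorokhod R q)).
Proof.
move=> pX; apply: (measurable_fun_borel_cvg compatible_j1_dist
  (X_ := fun n w => step_path (quantize n (X w)))).
- by move=> n; exact: measurable_step_quantize.
- by move=> w; exact: step_path_cvg.
Qed.

End step_paths.

(** * Integrals of processes *)

Section integrals_of_processes.
Context {R : realType} {disp : measure_display} {W : measurableType disp}.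
Notation mu := (@lebesgue_measure R).
Implicit Types (Y : W -> R -> R).

(** By right continuity, the process is the limit of its values at the next grid
point, which are jointly measurable because they involve countably many
times. *)
Lemma measurable_process_pair Y : (forall w, cadlag (Y w)) ->
  (forall t, 0 <= t -> measurable_fun setT (Y^~ t)) ->
  measurable_fun ([set: W] `*` `[(0:R), +oo[%classic) (fun p => Y p.1 p.2).
Proof.
move=> cY mY.
pose h (n : nat) (p : W * R) :=
  Y p.1 (((Num.floor (n.+1%:R * p.2))%:~R + 1) / n.+1%:R).
apply: (measurable_fun_cvg (h := h)) => [n _ A mA|[w t] /= [_]].
  rewrite [X in measurable X](_ : _ = \bigcup_(k : nat)
      ((Y^~ ((k%:R + 1) / n.+1%:R)) @^-1` A `*`
       `[k%:R / n.+1%:R : R, (k%:R + 1) / n.+1%:R[%classic)).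
    apply: bigcup_measurable => k _; apply: measurableX.
      rewrite -[X in measurable X]setTI; exact: mY.
    exact: measurable_itv.
  have n0 : (0 : R) < n.+1%:R by rewrite ltr0n.
  apply/seteqP; split=> -[w t] /=.
    rewrite in_itv/= andbT => -[[_ t0] At].
    have F0 : 0 <= Num.floor (n.+1%:R * t) by rewrite floor_ge0 mulr_ge0// ltW.
    have /andP[f1 f2] := floor_itv (n.+1%:R * t).
    have jE : `|Num.floor (n.+1%:R * t)|%N%:R = (Num.floor (n.+1%:R * t))%:~R :> R.
      by rewrite natr_absz ger0_norm.
    exists `|Num.floor (n.+1%:R * t)|%N => //=; rewrite jE; split=> //.
    rewrite /= in_itv/= ler_pdivrMr// ltr_pdivlMr//.
    by rewrite rmorphD/= in f2; rewrite ![t * _]mulrC f1.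
  move=> [k _ [/= Ak]]; rewrite !in_itv/= andbT ler_pdivrMr// ltr_pdivlMr// => tk.
  have t0 : 0 <= t.
    by case/andP: tk => tk _; rewrite -(pmulr_lge0 _ n0) (le_trans _ tk).
  split=> //.
  rewrite /h/= (@floor_def _ _ k%:Z)//.
  by rewrite rmorphD/= ![_ * t]mulrC.
rewrite in_itv/= andbT => t0.
have /cvg_at_rightP := (cY w).1 t t0; apply; split; last exact: cvg_floor_right.
move=> n; rewrite ltr_pdivlMr ?ltr0n// mulrC.
by have /andP[_] := floor_itv (n.+1%:R * t); rewrite rmorphD.
Qed.

Lemma measurable_integral_snd (f : W * R -> R) : measurable_fun setT f ->
  measurable_fun setT (fun w => \int[mu]_s f (w, s)).
Proof.
move=> mf; have mEf : measurable_fun setT (EFin \o f) by exact/measurable_EFinP.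
apply: (measurableT_comp (fine_measurable measurableT)) => /=.
rewrite (_ : (fun w => _) = fun w =>
    (fubini_F mu (EFin \o f)^\+ w - fubini_F mu (EFin \o f)^\- w)%E).
  by apply: emeasurable_funB; apply: measurable_fun_fubini_tonelli_F => //;
    [exact: measurable_funepos|exact: measurable_funeneg].
apply/funext => w; rewrite integralE; congr (_ - _)%E; apply: eq_integral => s _.
  by rewrite !funeposE.
by rewrite !funenegE.
Qed.

Lemma measurable_int_process Y (t : R) : (forall w, cadlag (Y w)) ->
  (forall s, 0 <= s -> measurable_fun setT (Y^~ s)) ->
  measurable_fun setT (fun w => \int[mu]_(s in `[0, t]) Y w s).
Proof.
move=> cY mY; pose D := [set: W] `*` `[(0:R), t]%classic.
have mD : measurable D by apply: measurableX => //; exact: measurable_itv.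
have mYD : measurable_fun setT ((fun p => Y p.1 p.2) \_ D).
  apply/(measurable_restrictT _ mD).
  apply: measurable_funS (measurable_process_pair cY mY).
    by apply: measurableX => //; exact: measurable_itv.
  by move=> [w s] [_] /=; rewrite !in_itv/= => /andP[->].
have := measurable_integral_snd mYD.
rewrite [X in measurable_fun _ X -> _](_ : _ =
  fun w => \int[mu]_(s in `[0, t]) Y w s)//.
apply/funext => w; rewrite [RHS]Rintegral_mkcond; apply: eq_Rintegral => s _.
by rewrite /patch /D in_setX in_setT.
Qed.

(** The property [is_process] for maps that are not yet packed as elements of
the path space. *)
Definition measurable_coords (q : nat) (Y : W -> R -> 'cV[R]_q) : Prop :=
  forall t, 0 <= t -> forall i, measurable_fun setT (fun w => Y w t i 0).

Lemma measurable_coords_vint q (Y : W -> R -> 'cV[R]_q) :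
  (forall w, cadlag (Y w)) -> measurable_coords Y ->
  measurable_coords (fun w => vint (Y w)).
Proof.
move=> cY mY t t0 i.
rewrite (_ : (fun w => _) = fun w => \int[mu]_(s in `[0, t]) Y w s i 0).
  apply: (measurable_int_process (Y := fun w s => Y w s i 0)) => [w|s s0].
    exact: (cadlag_mxP _).1 (cY w) i 0.
  exact: mY.
by apply/funext => w; rewrite mxE.
Qed.

Lemma measurable_coords_col_mx p q (Y : W -> R -> 'cV[R]_p)
    (Z : W -> R -> 'cV[R]_q) :
  measurable_coords Y -> measurable_coords Z ->
  measurable_coords (fun w t => col_mx (Y w t) (Z w t)).
Proof.
move=> mY mZ t t0 i; case: (split_ordP i) => k ->.
- by under eq_fun do rewrite col_mxEu; exact: mY.
- by under eq_fun do rewrite col_mxEd; exact: mZ.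
Qed.

Lemma is_process_Phi d (X : W -> skorokhod R d) :
  is_process X -> is_process (Phi \o X).
Proof.
move=> mX; apply: (measurable_coords_col_mx mX).
have cX w : cadlag (X w) by exact: path_cadlag.
have mI := measurable_coords_vint cX mX.
apply: (measurable_coords_col_mx mI); apply: measurable_coords_vint mI.
by move=> w; exact: cadlag_vint.
Qed.

Lemma is_process_Phin d (n : nat) (X : W -> skorokhod R d) :
  is_process X -> is_process (Phin n \o X).
Proof.
move=> mX; have cX w : cadlag (X w) by exact: path_cadlag.
have mI := measurable_coords_vint cX mX.
have mIg : measurable_coords (fun w t => vint (X w) (grid n t)).
  by move=> t t0; apply: mI; exact: grid_ge0.
apply: (measurable_coords_col_mx mX); apply: (measurable_coords_col_mx mIg).
move=> t t0; apply: (measurable_coords_vint _ mIg); last exact: grid_ge0.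
by move=> w; exact: cadlag_floor.
Qed.

End integrals_of_processes.

(** * Uniform estimates *)

Section uniform_estimates.
Context {R : realType}.
Notation mu := (@lebesgue_measure R).

Lemma within_continuous_unif (V : normedModType R) (f : R -> V) (T e : R) :
  {within `[0, +oo[, continuous f} -> 0 < e ->
  exists2 d : R, 0 < d & forall s t, 0 <= s <= T -> 0 <= t ->
    `|s - t| < d -> `|f s - f t| < e.
Proof.
move=> /within_continuous_ge0P fc e0.
have : \forall d \near 0^'+, `[0, T]%classic `<=`
    [set s | forall t, 0 <= s -> 0 <= t -> `|s - t| < d -> `|f s - f t| < e].
  have /compact_near_coveringP cpt := @segment_compact R 0 T.
  apply: (cpt _ _ (fun d s => forall t, 0 <= s -> 0 <= t ->
    `|s - t| < d -> `|f s - f t| < e)) => x.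
  rewrite /= in_itv/= => /andP[x0 _].
  have [d d0 xd] := fc x (e / 2) x0 ltac:(lra).
  have d20 : 0 < d / 2 by rewrite divr_gt0.
  exists ([set s | `|s - x| < d / 2], [set d' | d' < d / 2]).
    split => /=; last exact: nbhs_right_lt.
    by apply/nbhs_ballP; exists (d / 2) => // s; rewrite -ball_normE/= distrC.
  move=> [s d'] /= [sx dd] t s0 t0 st.
  have fs : `|f s - f x| < e / 2 by apply: xd => //; lra.
  have ft : `|f t - f x| < e / 2.
    apply: xd => //; rewrite -(subrKA s) (le_lt_trans (ler_normD _ _))//.
    by rewrite distrC; lra.
  rewrite -[f s - _](subrKA (f x)) (le_lt_trans (ler_normD _ _))//.
  by rewrite [X in _ + X]distrC; lra.
move=> H; near (0 : R)^'+ => d; exists d => [|s t sT t0 st]; first by [].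
have sub : `[0, T]%classic `<=`
    [set s | forall t, 0 <= s -> 0 <= t -> `|s - t| < d -> `|f s - f t| < e].
  by near: d.
by apply: sub st => //; case/andP: sT.
Unshelve. all: by end_near. Qed.

(** Near a continuous path, J1 proximity is uniform proximity: the time change
moves the continuous path by little. *)
Lemma j1_nbh_unif q (f : skorokhod R q) (T e : R) :
  {within `[0, +oo[, continuous f} -> 0 < e ->
  exists T' d : R, 0 < d /\ forall g, j1_nbh f T' d g ->
    forall t, 0 <= t <= T -> `|g t - f t| <= e.
Proof.
move=> fc e0; have e20 : 0 < e / 2 by lra.
have [d d0 fd] := within_continuous_unif T fc e20.
exists (T + d), (Num.min d (e / 2)); split; first by rewrite lt_min d0.
move=> g [lam [tl lam1 lam2]] t /andP[t0 tT].
have [s s0 st] := time_change_surj tl t0.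
have := lam1 s s0; rewrite st lt_min => /andP[sd _].
have sT : s <= T + d by move: sd; rewrite ltr_norml => /andP[? ?]; lra.
have := lam2 s; rewrite s0 sT st => /(_ isT); rewrite lt_min => /andP[_ gf].
rewrite -[g t - _](subrKA (f s)) (le_trans (ler_normD _ _))//.
have fst_ : `|f t - f s| < e / 2 by apply: fd => //; rewrite t0.
by rewrite [X in _ + X]distrC; lra.
Qed.

Lemma Rintegral_itv_bound (a : R -> R) (b : bool) (u v M : R) :
  u <= v -> mu.-integrable [set` Interval (BSide b u) (BRight v)] (EFin \o a) ->
  (forall t, u <= t <= v -> `|a t| <= M) ->
  `|\int[mu]_(t in [set` Interval (BSide b u) (BRight v)]) a t| <= M * (v - u).
Proof.
move=> uv ia aM; set D := [set` _].
have mD : measurable D by exact: measurable_itv.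
have muD : mu D = (v - u)%:E.
  rewrite /D lebesgue_measure_itv/= lte_fin; case: ltP => // vu.
  have -> : v = u by apply/le_anti; rewrite vu uv.
  by rewrite subrr.
have iM : mu.-integrable D (EFin \o cst M).
  apply: measurable_bounded_integrable => //; first by have := ltry (v - u); rewrite -muD.
  exists `|M|; split; first exact: num_real.
  by move=> N MN t _; exact: ltW.
rewrite (le_trans (le_normr_Rintegral _ _))//.
apply: le_trans (_ : \int[mu]_(t in D) (cst M) t <= _).
  apply: le_Rintegral => //.
    by have := integrable_norm ia.
  move=> t; rewrite /D/= in_itv/= => /andP[ut tv]; apply: aM; rewrite tv andbT.
  by case: (b) ut => [//|/ltW].
by rewrite Rintegral_cst// -[v - u]/(fine (v - u)%:E) -muD.
Qed.

(** The bound [e * s] comes from the difference of the integrands on [0, s], and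
[M * (t - s)] from the remaining piece. *)
Lemma int_close (a b : R -> R) (s t e M : R) :
  cadlag a -> cadlag b -> 0 <= s <= t ->
  (forall r, 0 <= r <= t -> `|a r - b r| <= e) ->
  (forall r, 0 <= r <= t -> `|b r| <= M) ->
  `|\int[mu]_(r in `[0, s]) a r - \int[mu]_(r in `[0, t]) b r| <=
    e * s + M * (t - s).
Proof.
move=> ca cb /andP[s0 st] ab bM.
have ia u := integrable_cadlag u ca; have ib u := integrable_cadlag u cb.
have -> : \int[mu]_(r in `[0, s]) a r - \int[mu]_(r in `[0, t]) b r =
    \int[mu]_(r in `[0, s]) (a r - b r) - \int[mu]_(r in `]s, t]) b r.
  rewrite RintegralB// -(Rintegral_itvB (ib t)) ?bnd_simp//; ring.
rewrite (le_trans (ler_normB _ _))// lerD//.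
  rewrite -[X in _ <= _ * X]subr0; apply: Rintegral_itv_bound => //.
    rewrite (_ : EFin \o _ = (EFin \o a) \- (EFin \o b))%E//.
    by apply: integrableB => //; exact: measurable_itv.
  by move=> r /andP[r0 rs]; apply: ab; rewrite r0 (le_trans rs).
apply: Rintegral_itv_bound => //.
  apply: integrableS (ib t); rewrite /=; do ?exact: measurable_itv.
  by move=> r /=; rewrite !in_itv/= => /andP[sr ->]; rewrite (le_trans s0 (ltW sr)).
by move=> r /andP[sr rt]; apply: bM; rewrite rt (le_trans s0).
Qed.

Lemma vint_close q (a b : R -> 'cV[R]_q) (s t e M : R) :
  cadlag a -> cadlag b -> 0 <= s <= t ->
  (forall r, 0 <= r <= t -> `|a r - b r| <= e) ->
  (forall r, 0 <= r <= t -> `|b r| <= M) ->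
  `|vint a s - vint b t| <= e * s + M * (t - s).
Proof.
move=> ca cb st ab bM; have /andP[s0 st'] := st.
have t0 : 0 <= t by exact: le_trans st'.
have e0 : 0 <= e by apply: le_trans (ab 0 _); rewrite ?lexx.
have M0 : 0 <= M by apply: le_trans (bM 0 _); rewrite ?lexx.
apply: mx_norm_le => [|i j].
  by rewrite addr_ge0// mulr_ge0// subr_ge0.
rewrite !mxE; apply: int_close => //.
- exact: (cadlag_mxP _).1 ca i 0.
- exact: (cadlag_mxP _).1 cb i 0.
- move=> r rt; apply: le_trans (ab r rt).
  by have := mx_norm_ge (a r - b r) i 0; rewrite !mxE.
- by move=> r rt; apply: le_trans (bM r rt); exact: mx_norm_ge.
Qed.

Lemma cadlag_norm_bounded (V : normedModType R) (f : R -> V) (T : R) : cadlag f ->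
  exists M : R, forall t, 0 <= t <= T -> `|f t| <= M.
Proof.
move=> [fr fl]; have /(cadlag_bounded T)[M fM] : cadlag (fun t => `|f t|).
  split=> t t0; first by apply: cvg_norm; exact: fr.
  by have [l fl'] := fl t t0; exists `|l|; apply: cvg_norm.
by exists M => t /fM; rewrite normr_id.
Qed.

End uniform_estimates.

(** * Convergence of the integral maps *)

Section convergence_of_integral_maps.
Context {R : realType}.

Lemma col_mx_norm_le m n (x : 'cV[R]_m) (y : 'cV[R]_n) (c : R) :
  `|x| <= c -> `|y| <= c -> `|col_mx x y| <= c.
Proof.
move=> xc yc; apply: mx_norm_le => [|i j]; first exact: le_trans xc.
by case: (split_ordP i) => k ->; rewrite ?col_mxEu ?col_mxEd;
  [apply: le_trans xc|apply: le_trans yc]; exact: mx_norm_ge.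
Qed.

(** The estimate on integrals is applied twice: to [g] and [f], then to the
integral of [g] read on the grid and the integral of [f].  Each time the cost is
a multiple of the previous error and of the grid step. *)
Lemma Phin_close d (f : skorokhod R d) (T e : R) :
  {within `[0, +oo[, continuous f} -> 0 < e ->
  exists T' dl : R, 0 < dl /\ \forall n \near \oo, forall g,
    j1_nbh f T' dl g -> forall t, 0 <= t <= T ->
    `|Phin n.+1 g t - Phi f t| <= e.
Proof.
move=> fc e0; have [T0|T0] := ltP T 0.
  exists 0, 1; split => //; apply: nearW => n g _ t /andP[t0 tT].
  by have := le_lt_trans (le_trans t0 tT) T0; rewrite ltxx.
have cf : cadlag f by exact: path_cadlag.
have cIf := cadlag_vint cf.
have [M fM] := cadlag_norm_bounded T cf.
have [M' fM'] := cadlag_norm_bounded T cIf.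
have M0 : 0 <= M by apply: le_trans (fM 0 _); rewrite ?lexx.
have M'0 : 0 <= M' by apply: le_trans (fM' 0 _); rewrite ?lexx.
(* [e2] is the error allowed on the first integral, [e1] on the path, each small
   enough for the next integration over [0, T] to turn it into half of the
   following error. *)
pose e2 := Num.min e (e / (2 * (T + 1))).
have T1 : 0 < 2 * (T + 1) by lra.
have e20 : 0 < e2 by rewrite lt_min e0 divr_gt0.
have e2e : e2 <= e by rewrite ge_min lexx.
have Te2 : T * e2 <= e / 2.
  apply: (@le_trans _ _ ((T + 1) * (e / (2 * (T + 1))))).
    by apply: ler_pM; rewrite ?(ltW e20) ?ge_min ?lexx ?orbT//; lra.
  by rewrite le_eqVlt; apply/orP; left; apply/eqP; field; lra.
pose e1 := Num.min e (e2 / (2 * (T + 1))).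
have e10 : 0 < e1 by rewrite lt_min e0 divr_gt0.
have e1e : e1 <= e by rewrite ge_min lexx.
have Te1 : T * e1 <= e2 / 2.
  apply: (@le_trans _ _ ((T + 1) * (e2 / (2 * (T + 1))))).
    by apply: ler_pM; rewrite ?(ltW e10) ?ge_min ?lexx ?orbT//; lra.
  by rewrite le_eqVlt; apply/orP; left; apply/eqP; field; lra.
have [T' [dl [dl0 unif]]] := j1_nbh_unif T fc e10.
exists T', dl; split => //.
have e3 : 0 < e2 / (2 * (M + M' + 1)) by rewrite divr_gt0//; lra.
near=> n => g /unif fg t /andP[t0 tT].
have n0 : 0 <= n.+1%:R^-1 :> R by rewrite invr_ge0.
have hn : (M + M' + 1) * n.+1%:R^-1 <= e2 / 2.
  have : n.+1%:R^-1 < e2 / (2 * (M + M' + 1)).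
    by near: n; exact: (near_infty_natSinv_lt (PosNum e3)).
  rewrite ltr_pdivlMr; last lra.
  set h := n.+1%:R^-1; move=> ?; lra.
have Mn : M * n.+1%:R^-1 <= e2 / 2.
  by apply: le_trans hn; rewrite ler_wpM2r//; lra.
have M'n : M' * n.+1%:R^-1 <= e2 / 2.
  by apply: le_trans hn; rewrite ler_wpM2r//; lra.
have cg : cadlag g by exact: path_cadlag.
have gridP (r : R) : 0 <= r -> 0 <= grid n.+1 r <= r.
  by move=> r0; rewrite grid_ge0//= grid_le.
have gridB (r : R) : r - grid n.+1 r <= n.+1%:R^-1.
  by have := grid_gt n r; rewrite ltrBlDr -ltrBlDl => /ltW.
have fM_ r : r <= T -> forall x, 0 <= x <= r -> `|f x| <= M.
  by move=> rT x /andP[x0 xr]; apply: fM; rewrite x0 (le_trans xr).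
have fM'_ r : r <= T -> forall x, 0 <= x <= r -> `|vint f x| <= M'.
  by move=> rT x /andP[x0 xr]; apply: fM'; rewrite x0 (le_trans xr).
have int1 r : 0 <= r <= T -> `|vint g (grid n.+1 r) - vint f r| <= e2.
  move=> /andP[r0 rT]; have /andP[gr0 gr] := gridP r r0.
  have fg_ x : 0 <= x <= r -> `|g x - f x| <= e1.
    by move=> /andP[x0 xr]; apply: fg; rewrite x0 (le_trans xr).
  apply: le_trans (vint_close cg cf (gridP r r0) fg_ (fM_ r rT)) _.
  rewrite [leRHS]splitr lerD//.
    by apply: le_trans Te1; rewrite mulrC ler_wpM2r ?(ltW e10)// (le_trans gr).
  by apply: le_trans Mn; rewrite ler_wpM2l.
have int2 : `|vint (fun r => vint g (grid n.+1 r)) (grid n.+1 t) -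
              vint (vint f) t| <= e.
  have /andP[gt0 gt] := gridP t t0.
  have cIg : cadlag (fun r => vint g (grid n.+1 r)) by exact: cadlag_floor.
  have int1_ x : 0 <= x <= t -> `|vint g (grid n.+1 x) - vint f x| <= e2.
    by move=> /andP[x0 xt]; apply: int1; rewrite x0 (le_trans xt).
  apply: le_trans (vint_close cIg cIf (gridP t t0) int1_ (fM'_ t tT)) _.
  rewrite [leRHS]splitr lerD//.
    by apply: le_trans Te2; rewrite mulrC ler_wpM2r ?(ltW e20)// (le_trans gt).
  apply: (@le_trans _ _ (M' * n.+1%:R^-1)); first by rewrite ler_wpM2l.
  by apply: le_trans M'n _; lra.
rewrite /= /Phin_fun /Phi_fun !opp_col_mx !add_col_mx.
apply: col_mx_norm_le; first by apply: le_trans e1e; apply: fg; rewrite t0.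
apply: col_mx_norm_le => //; apply: le_trans e2e; apply: int1; rewrite t0.
by [].
Unshelve. all: by end_near. Qed.

Lemma Phin_cvg d (f : skorokhod R d) : {within `[0, +oo[, continuous f} ->
  Phin p.1.+1 p.2 @[p --> (\oo, nbhs f)] --> Phi f.
Proof.
move=> fc A /nbhs_j1_nbh[T [e [e0 sA]]].
have e20 : 0 < e / 2 by rewrite divr_gt0.
have [T' [dl [dl0 near_f]]] := Phin_close T fc e20.
suff : \forall p \near (\oo, nbhs f), j1_nbh (Phi f) T e (Phin p.1.+1 p.2).
  by apply: filterS => p /sA.
exists ([set n | forall g, j1_nbh f T' dl g -> forall t, 0 <= t <= T ->
    `|Phin n.+1 g t - Phi f t| <= e / 2], j1_nbh f T' dl).
  by split => //=; exact: j1_nbh_nbhs.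
move=> [n g] /= [nf fg]; exists id; split; first exact: time_change_id.
  by move=> t _; rewrite subrr normr0.
by move=> t tT; apply: le_lt_trans (nf g fg t tT) _; lra.
Qed.

(** A J1 limit of continuous paths is, locally uniformly, a limit of continuous
paths composed with time changes, which are continuous.  Closedness makes the
event that a process has continuous paths measurable. *)
Lemma closed_continuous_paths q :
  closed [set f : skorokhod R q | {within `[0, +oo[, continuous f}].
Proof.
move=> f clf; apply/within_continuous_ge0P => t e t0 e0.
have e30 : 0 < e / 3 by rewrite divr_gt0.
have [g [/= /within_continuous_ge0P gc]] := clf _ (j1_nbh_nbhs f (t + 1) e30).
move=> [lam [tl _ fg]]; have [_ _ /within_continuous_ge0P lamc _] := tl.
have lt0 := time_change_ge0 tl t0.
have [d d0 gd] := gc (lam t) (e / 3) lt0 e30.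
have [d' d'0 ld] := lamc t d t0 d0.
exists (Num.min d' 1); first by rewrite lt_min d'0 ltr01.
move=> s s0; rewrite lt_min => /andP[sd' s1].
have sT : 0 <= s <= t + 1.
  by rewrite s0/=; move: s1; rewrite ltr_norml => /andP[? ?]; lra.
have tT : 0 <= t <= t + 1 by rewrite t0/= lerDl.
have h1 := fg s sT; have h2 := fg t tT.
have h3 : `|g (lam s) - g (lam t)| < e / 3.
  by apply: gd; [exact: time_change_ge0|exact: ld].
have -> : f s - f t =
    (f s - g (lam s)) + (g (lam s) - g (lam t)) + (g (lam t) - f t).
  by rewrite !subrKA.
have := ler_normD (f s - g (lam s) + (g (lam s) - g (lam t))) (g (lam t) - f t).
have := ler_normD (f s - g (lam s)) (g (lam s) - g (lam t)).
rewrite (distrC (f s)); lra.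
Qed.

End convergence_of_integral_maps.

(** * Weak convergence *)

(* [U_ n] and [P_ n] stand for the paper's process of index [n + 1], and the
   probability measure of the space on which it is defined. *)
Theorem lemmaC8 (R : realType) (d : nat) (d_gt0 : (0 < d)%N)
  (disp : measure_display) (W : measurableType disp) (P : probability W R)
  (U : W -> skorokhod R d)
  (disp_ : nat -> measure_display) (W_ : forall n, measurableType (disp_ n))
  (P_ : forall n, probability (W_ n) R) (U_ : forall n, W_ n -> skorokhod R d)
  (U_process : is_process U) (U__process : forall n, is_process (U_ n))
  (U_continuous : P [set w | {within `[0, +oo[, continuous (U w)}] = 1%E)
  (U_cvg : cvg_in_law P_ U_ P U) :
  cvg_in_law P_ (fun n => Phin n.+1 \o U_ n) P (Phi \o U).
Proof.
have [X_ [X [X_E XE X_cvg]]] := U_cvg.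
have mPhin n : measurable_fun setT
    (Phin n.+1 \o U_ n : W_ n -> borel (skorokhod R (d + (d + d)))).
  exact/measurable_process/is_process_Phin.
have mPhi : measurable_fun setT
    (Phi \o U : W -> borel (skorokhod R (d + (d + d)))).
  exact/measurable_process/is_process_Phi.
have X_UE n : (X_ n : W_ n -> skorokhod R d) = U_ n by apply/funext.
have XUE : (X : W -> skorokhod R d) = U by apply/funext.
have U_cts : {ae P, forall w, {within `[0, +oo[, continuous (U w)}}.
  have mU : measurable [set w | {within `[0, +oo[, continuous (U w)}].
    rewrite -XUE -[X in measurable X]setCK; apply: measurableC.
    pose C := [set f : skorokhod R d | {within `[0, +oo[, continuous f}].
    have oC : open (~` C) by exact/closed_openC/closed_continuous_paths.
    rewrite -[X in measurable X]setTI.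
    exact: (@measurable_funPT _ _ _ _ X _ _ (open_borel_measurable oC)).
  exists (~` [set w | {within `[0, +oo[, continuous (U w)}]).
  by split; [exact: measurableC|rewrite probability_setC// U_continuous subee|].
exists (fun n => mfun_Sub (mem_set (mPhin n))), (mfun_Sub (mem_set mPhi)).
split=> //; apply: (extended_mapping_weak_cvg compatible_j1_dist
  (Psi_ := fun n => Phin n.+1) (Psi := Phi) X_cvg) => //.
- by move=> n; rewrite X_UE.
- by rewrite XUE.
- by apply: filterS U_cts => w Uw; rewrite XE; exact: Phin_cvg.
- by move=> n w; rewrite X_E.
- by move=> w; rewrite XE.
Qed.
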